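(* Let $\mu$ be a compactly supported probability measure on $[0,\infty)$, not a Dirac measure, with mean $m_1(\mu)=\int_0^\infty s\,d\mu(s)=1$. For $t>1$ let $\|\mu^{\boxtimes t}\|=\max\{m : m\in\mathrm{supp}(\mu^{\boxtimes t})\}$. Then $$\lim_{t\to\infty}\frac{\|\mu^{\boxtimes t}\|}{t}=eV,$$ where $V$ is the variance of $\mu$.
   Context: For a probability measure $\mu$ on $[0,\infty)$ that is not a Dirac measure, let $\psi_\mu(z)=\int_0^\infty \frac{zs}{1-zs}\,d\mu(s)$ and $\eta_\mu(z)=\psi_\mu(z)/(1+\psi_\mu(z))$ for $z\in\mathbb{C}\setminus[0,\infty)$. Then $\eta_\mu'>0$ on $(-\infty,0)$, so $\eta_\mu|_{(-\infty,0)}$ is invertible with inverse $\eta_\mu^{-1}$, and one sets $\Sigma_\mu(z)=\eta_\mu^{-1}(z)/z>0$ for $z<0$ sufficiently close to $0$. For real $t>1$, the free multiplicative convolution power $\mu^{\boxtimes t}$ is the (existing and unique) probability measure on $[0,\infty)$ with $\Sigma_{\mu^{\boxtimes t}}(z)=\Sigma_\mu(z)^t$ for $z<0$ sufficiently close to $0$; for integer $t=n$ it is the $n$-fold free multiplicative convolution of $\mu$. $\mathrm{supp}(\mu)$ denotes the (closed) support of $\mu$. *)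

(* Defs.v *)
From HB Require Import structures.
From mathcomp Require Import all_boot all_order all_algebra.
From mathcomp Require Import all_classical all_reals all_analysis.

Set Implicit Arguments.
Unset Strict Implicit.
Unset Printing Implicit Defensive.

Import Order.TTheory GRing.Theory Num.Theory.
Import numFieldNormedType.Exports.

Local Open Scope classical_set_scope.
Local Open Scope ring_scope.

Definition on_nonneg (R : realType) (mu : probability (measurableTypeR R) R)
  : Prop := mu `[0, +oo[%classic = 1%E.

(* Quantified over measurable sets only: a measure is a function on all sets,
   and its values outside the sigma-algebra carry no information. *)
Definition is_dirac (R : realType) (mu : probability (measurableTypeR R) R)
  : Prop :=
  exists a : R, forall A : set (measurableTypeR R), measurable A ->
    mu A = \d_a A.

Definition supp (R : realType) (mu : probability (measurableTypeR R) R)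
  : set R :=
  [set x | forall U : set R, open U -> U x -> (0 < mu U)%E].

(* The largest element of the support, 0 by convention if there is none. *)
Definition supp_max (R : realType) (mu : probability (measurableTypeR R) R)
  : R := xget 0 (supp mu `&` ubound (supp mu)).

(* psi and eta are real-valued on the negative half-line, the only part of
   their domain that enters Sigma. *)
Definition psi (R : realType) (mu : probability (measurableTypeR R) R) (z : R)
  : R := \int[mu]_(s in `[0, +oo[%classic) (z * s / (1 - z * s)).

Definition eta (R : realType) (mu : probability (measurableTypeR R) R) (z : R)
  : R := psi mu z / (1 + psi mu z).

(* Inverse of the restriction of eta to ]-oo, 0[, extended by 0 outside the
   range of that restriction. *)
Definition eta_inv (R : realType) (mu : probability (measurableTypeR R) R)
  : R -> R := 'pinv_(fun=> 0) `]-oo, 0[%classic (eta mu).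

Definition Sigma (R : realType) (mu : probability (measurableTypeR R) R) (z : R)
  : R := eta_inv mu z / z.

(* [nu] is the free multiplicative convolution power of [mu] of exponent [t];
   Sigma is only meaningful away from Dirac measures. *)
Definition free_mul_power (R : realType)
    (mu : probability (measurableTypeR R) R) (t : R)
    (nu : probability (measurableTypeR R) R) : Prop :=
  [/\ on_nonneg nu, ~ is_dirac nu &
      \forall z \near 0^'-, Sigma nu z = Sigma mu z `^ t].

(* Main.v *)
(** Write [psi] for the psi-transform of [mu], [q x = eta_mu x / x = 1 + V x + ...]
    and [k_t x = x * q(x)^(1-t)].  The defining relation of [mu^t] says that
    [psi_(mu^t) (k_t x) = psi x] for [x < 0] close to [0].  As [psi x] is a
    power series in [x], this is an asymptotic expansion of [psi_(mu^t)] at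
    [0-], so by Fatou's lemma all moments of [mu^t] are finite, and they are
    the coefficients of the formal power series [psi (k_t^-1 y)].  No analytic
    continuation is needed: the support is read off the growth of the moments.

    With [x = u / t], [t * k_t x] tends to [u exp (- V u)] as [t] grows, whose
    maximum for [u > 0] is [1 / (e V)], at [u = 1 / V].  The majorant method for the
    fixed-point equation [U = Y exp ((t - 1) ln q (U / t))], with the weighted
    l1 norm on polynomials, bounds the moments of [mu^t] of order [j] by
    [(t e V (1 + O(1/t)))^j].  Conversely the rescaled moments of each fixed
    order converge to the coefficients of the solution of [T = Y exp (V T)],
    whose radius of convergence is at most [1 / (e V)], and moments of order
    [j + 1] are at most the [j]-th power of the maximum of the support times
    the mean. *)

Require Import Defs.
From mathcomp Require Import all_boot all_order all_algebra.
From mathcomp Require Import all_classical all_reals all_analysis.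
From mathcomp Require Import ring lra.

Set Implicit Arguments.
Unset Strict Implicit.
Unset Printing Implicit Defensive.

Import Order.TTheory GRing.Theory Num.Theory.
From mathcomp Require Import measurable_realfun.
Import numFieldNormedType.Exports.
Local Open Scope classical_set_scope.
Local Open Scope ring_scope.

(** * The weighted l1 norm on polynomials *)

Definition pnorm (R : numDomainType) (r : R) (p : {poly R}) : R :=
  (map_poly Num.norm p).[r].

Lemma pnorm_MXaddC (R : numDomainType) (r : R) (p : {poly R}) (c : R) :
  pnorm r (p * 'X + c%:P) = pnorm r p * r + `|c|.
Proof.
rewrite /pnorm.
have -> : map_poly Num.norm (p * 'X + c%:P)
          = map_poly Num.norm p * 'X + `|c|%:P :> {poly R}.
  apply/polyP => i.
  rewrite coef_map_id0 ?normr0 // !coefD !coefMX !coefC.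
  case: i => [|i] /=; first by rewrite !add0r.
  by rewrite !addr0 coef_map_id0 ?normr0.
by rewrite !hornerE.
Qed.

Lemma pnormC (R : numDomainType) (r c : R) : pnorm r c%:P = `|c|.
Proof.
have := pnorm_MXaddC r 0 c; rewrite mul0r add0r => ->.
by rewrite /pnorm map_poly0 horner0 mul0r add0r.
Qed.

Lemma pnorm0 (R : numDomainType) (r : R) : pnorm r (0 : {poly R}) = 0.
Proof. by rewrite /pnorm map_poly0 horner0. Qed.

Lemma pnormX (R : numDomainType) (r : R) : pnorm r ('X : {poly R}) = r.
Proof.
have := pnorm_MXaddC r (1%:P) 0; rewrite mul1r addr0 => ->.
by rewrite pnormC normr1 mul1r normr0 addr0.
Qed.

Lemma pnormE (R : numDomainType) (r : R) (p : {poly R}) n :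
  (size p <= n)%N -> pnorm r p = \sum_(i < n) `|p`_i| * r ^+ i.
Proof.
move=> pn; rewrite /pnorm (@horner_coef_wide _ n).
  by apply: eq_bigr => i _; rewrite coef_map_id0 ?normr0.
by rewrite (leq_trans _ pn)// size_poly.
Qed.

Section PNormTheory.
Variables (R : numDomainType) (r : R).
Hypothesis r0 : 0 <= r.

Lemma pnorm_ge0 (p : {poly R}) : 0 <= pnorm r p.
Proof.
rewrite (@pnormE _ _ _ (size p))// sumr_ge0// => i _.
by rewrite mulr_ge0// exprn_ge0.
Qed.

Lemma pnormD (p q : {poly R}) : pnorm r (p + q) <= pnorm r p + pnorm r q.
Proof.
set n := maxn (size p) (size q).
rewrite (@pnormE _ _ _ n) ?size_polyD//.
rewrite (@pnormE _ _ p n) ?leq_maxl// (@pnormE _ _ q n) ?leq_maxr//.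
rewrite -big_split /= ler_sum// => i _.
by rewrite -mulrDl ler_wpM2r ?exprn_ge0// coefD ler_normD.
Qed.

Lemma pnormZ (c : R) (p : {poly R}) : pnorm r (c *: p) = `|c| * pnorm r p.
Proof.
rewrite (@pnormE _ _ _ (size p)) ?size_scale_leq// (@pnormE _ _ p (size p))//.
by rewrite big_distrr /=; apply: eq_bigr => i _; rewrite coefZ normrM mulrA.
Qed.

Lemma coef_le_pnorm (p : {poly R}) j : `|p`_j| * r ^+ j <= pnorm r p.
Proof.
rewrite (@pnormE _ _ _ (maxn j.+1 (size p))) ?leq_maxr//.
have jn : (j < maxn j.+1 (size p))%N by rewrite leq_maxl.
rewrite (bigD1 (Ordinal jn)) //= lerDl sumr_ge0// => i _.
by rewrite mulr_ge0// exprn_ge0.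
Qed.

Lemma pnormM (p q : {poly R}) : pnorm r (p * q) <= pnorm r p * pnorm r q.
Proof.
elim/poly_ind: p => [|p c IH]; first by rewrite mul0r !pnorm0 mul0r.
rewrite mulrDl mul_polyC pnorm_MXaddC mulrDl.
apply: le_trans (pnormD _ _) _; rewrite pnormZ lerD2r.
rewrite -mulrA (mulrC 'X) mulrA -[X in pnorm _ X]addr0 pnorm_MXaddC normr0 addr0.
by rewrite mulrAC ler_wpM2r.
Qed.

End PNormTheory.

Lemma ler_pnorm (R : numDomainType) (p : {poly R}) (r s : R) :
  0 <= r -> r <= s -> pnorm r p <= pnorm s p.
Proof.
move=> r0 rs; rewrite !(@pnormE _ _ _ (size p))// ler_sum// => i _.
by rewrite ler_wpM2l// lerXn2r ?nnegrE// (le_trans r0).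
Qed.

(** Horner induction with [pnormM]: a composition of polynomials is majorised by the composition of
    their majorants. The fixed-point bound [pnorm_inv_poly] rests on this. *)
Lemma pnorm_comp (R : numDomainType) (r : R) (p q : {poly R}) :
  0 <= r -> pnorm r (p \Po q) <= pnorm (pnorm r q) p.
Proof.
move=> r0; elim/poly_ind: p => [|p c IH]; first by rewrite comp_poly0 !pnorm0.
rewrite comp_polyD comp_polyM comp_polyX comp_polyC pnorm_MXaddC.
apply: le_trans (pnormD r0 _ _) _; rewrite pnormC lerD2r.
by apply: le_trans (pnormM r0 _ _) _; rewrite ler_wpM2r ?pnorm_ge0.
Qed.

(** * Truncated exponential and logarithm *)

Definition exp_poly (R : fieldType) N : {poly R} :=
  \poly_(i < N.+1) i`!%:R^-1.

(* The coefficient of index 0 is [-1 / 0 = 0]. *)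
Definition log_poly (R : fieldType) N : {poly R} :=
  \poly_(i < N.+1) ((-1) ^+ i.+1 / i%:R).

Lemma pnorm_exp_poly (R : realType) N (r : R) :
  0 <= r -> pnorm r (exp_poly R N) <= expR r.
Proof.
move=> r0; rewrite (@pnormE _ _ _ N.+1) ?size_poly//.
rewrite (_ : \sum_(i < N.+1) _ = series (exp_coeff r) N.+1); last first.
  rewrite /series /= big_mkord; apply: eq_bigr => i _.
  by rewrite coef_poly ltn_ord ger0_norm ?invr_ge0// mulrC.
rewrite /expR; apply: nondecreasing_cvgn_le; last exact: is_cvg_series_exp_coeff.
by apply: nondecreasing_series => i _ _; exact: exp_coeff_ge0.
Qed.

Lemma pnorm_log_poly (R : realType) N (r : R) :
  0 <= r -> r <= 2^-1 -> pnorm r (log_poly R N) <= 2 * r.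
Proof.
move=> r0 r2; rewrite (@pnormE _ _ _ N.+1) ?size_poly//.
(* Adding the tail [2 r^(N+1)] makes the bound inductive: [r^(N+1) + 2 r^(N+2) <= 2 r^(N+1)] because
   [r <= 1/2]. *)
suff : \sum_(i < N.+1) `|(log_poly R N)`_i| * r ^+ i + 2 * r ^+ N.+1
       <= 2 * r.
  by apply: le_trans; rewrite lerDl mulr_ge0// exprn_ge0.
have -> : \sum_(i < N.+1) `|(log_poly R N)`_i| * r ^+ i =
    \sum_(i < N.+1) `|(-1) ^+ i.+1 / i%:R| * r ^+ i :> R.
  by apply: eq_bigr => i _; rewrite coef_poly ltn_ord.
elim: N => [|N IH].
  by rewrite big_ord1 invr0 mulr0 normr0 mul0r add0r expr1.
rewrite big_ord_recr /=; apply: le_trans IH.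
rewrite -addrA lerD2l normrM normrX normrN1 expr1n mul1r.
have h : `|N.+1%:R^-1| <= 1 :> R.
  by rewrite ger0_norm ?invr_ge0// invf_le1// ler1n.
rewrite [r ^+ N.+2]exprS mulrA -mulrDl ler_wpM2r ?exprn_ge0//.
by lra.
Qed.

Lemma coef_comp_0 (R : comNzRingType) (p q : {poly R}) :
  q`_0 = 0 -> (p \Po q)`_0 = p`_0.
Proof. by move=> q0; rewrite -!horner_coef0 horner_comp (horner_coef0 q) q0. Qed.

Lemma coef_comp_1 (R : comNzRingType) (p q : {poly R}) :
  q`_0 = 0 -> (p \Po q)`_1 = p`_1 * q`_1.
Proof.
move=> q0; elim/poly_ind: p => [|p c _]; first by rewrite comp_poly0 !coef0 mul0r.
rewrite comp_polyD comp_polyM comp_polyX comp_polyC !coefD !coefC !addr0.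
by rewrite coefMX /= coefM big_ord_recl big_ord1 /= q0 mulr0 addr0 coef_comp_0.
Qed.

(* The sum of [m i X^i] over [1 <= i <= N], when [m 0 = 1]. *)
Definition series_poly (R : nzRingType) (m : nat -> R) N : {poly R} :=
  \poly_(i < N.+1) m i - 1.

Lemma coef_series_poly (R : nzRingType) (m : nat -> R) N i : m 0%N = 1 ->
  (series_poly m N)`_i = if (0 < i <= N)%N then m i else 0.
Proof.
move=> m0; rewrite coefB coef_poly coef1 ltnS.
by case: i => [|i] /=; rewrite ?m0 ?subrr ?subr0.
Qed.

Lemma size_series_poly (R : nzRingType) (m : nat -> R) N :
  (size (series_poly m N) <= N.+1)%N.
Proof.
rewrite (leq_trans (size_polyD _ _))// geq_max size_poly size_polyN.
by rewrite size_poly1.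
Qed.

(** The terms are dominated by powers of [K * x <= 1/3], and the geometric series of ratio [1/3]
    without its first term sums to [1/2], the radius allowed in [pnorm_log_poly]. *)
Lemma pnorm_series_poly (R : realFieldType) (m : nat -> R) N (K x : R) :
  m 0%N = 1 -> (forall i, `|m i| <= K ^+ i) -> 0 <= x -> 3 * (K * x) <= 1 ->
  pnorm x (series_poly m N) <= 2^-1.
Proof.
move=> m0 mK x0 Kx.
have K0 : 0 <= K by rewrite -[K]expr1 (le_trans _ (mK 1%N)).
have Kx0 : 0 <= K * x by rewrite mulr_ge0.
rewrite (@pnormE _ _ _ N.+1) ?size_series_poly//.
rewrite big_ord_recl coef_series_poly// normr0 mul0r add0r.
have -> : \sum_(i < N) `|(series_poly m N)`_(bump 0 i)| * x ^+ bump 0 i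
        = \sum_(i < N) `|m i.+1| * x ^+ i.+1.
  by apply: eq_bigr => i _; rewrite /bump /= add1n coef_series_poly// ltn_ord.
(* [2^-1 * 3^-1 ^+ N] is exactly the tail of that geometric series. *)
suff : \sum_(i < N) `|m i.+1| * x ^+ i.+1 + 2^-1 * 3^-1 ^+ N <= 2^-1.
  by apply: le_trans; rewrite lerDl mulr_ge0.
elim: N => [|N IH]; first by rewrite big_ord0 add0r expr0 mulr1.
rewrite big_ord_recr /=; apply: le_trans IH; rewrite -addrA lerD2l.
apply: (@le_trans _ _ (3^-1 ^+ N.+1 + 2^-1 * 3^-1 ^+ N.+1)).
  rewrite lerD2r; apply: (@le_trans _ _ ((K * x) ^+ N.+1)).
    by rewrite exprMn ler_wpM2r ?exprn_ge0.
  by rewrite lerXn2r ?nnegrE//; lra.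
by rewrite exprS; lra.
Qed.

(* Approximates the logarithm of [(sum_i m_(i+1) x^i) / (sum_i m_i x^i)]. *)
Definition log_ratio_poly (R : fieldType) (m : nat -> R) N : {poly R} :=
  (log_poly R N \Po series_poly (fun i => m i.+1) N)
  - (log_poly R N \Po series_poly m N).

Lemma coef_log_ratio_poly_0 (R : fieldType) (m : nat -> R) N :
  m 0%N = 1 -> m 1%N = 1 -> (log_ratio_poly m N)`_0 = 0.
Proof.
by move=> m0 m1; rewrite coefB !coef_comp_0 ?coef_series_poly// subrr.
Qed.

Lemma coef_log_ratio_poly_1 (R : fieldType) (m : nat -> R) N :
  m 0%N = 1 -> m 1%N = 1 -> (0 < N)%N ->
  (log_ratio_poly m N)`_1 = m 2%N - m 1%N.
Proof.
move=> m0 m1 N0; rewrite coefB !coef_comp_1 ?coef_series_poly// N0 /=.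
by rewrite coef_poly ltnS N0 divr1 expr2 mulrNN !mul1r.
Qed.

Lemma pnorm_log_ratio_poly (R : realType) (m : nat -> R) N (K x : R) :
  m 0%N = 1 -> m 1%N = 1 -> (forall i, `|m i| <= K ^+ i) ->
  (forall i, `|m i.+1| <= K ^+ i) -> 0 <= x -> 3 * (K * x) <= 1 ->
  pnorm x (log_ratio_poly m N) <= 2.
Proof.
move=> m0 m1 mK mK' x0 Kx.
have h (c : nat -> R) : c 0%N = 1 -> (forall i, `|c i| <= K ^+ i) ->
    pnorm x (log_poly R N \Po series_poly c N) <= 1.
  move=> c0 cK; apply: le_trans (pnorm_comp _ _ x0) _.
  have c2 := pnorm_series_poly N c0 cK x0 Kx.
  apply: le_trans (pnorm_log_poly _ (pnorm_ge0 x0 _) c2) _; lra.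
apply: le_trans (pnormD x0 _ _) _.
rewrite -scaleN1r (pnormZ _ (-1)) normrN1 mul1r.
have := h _ m0 mK; have := h (fun i => m i.+1) m1 mK'; lra.
Qed.

(** For [i >= 2], [(s / x)^i <= (s / x)^2]. With [s = u / t] the quadratic part is still [O(1/t)]
    after multiplication by [t], so only the linear coefficient survives for large [t]. *)
Lemma pnorm_le_linear_quadratic (R : realFieldType) (p : {poly R}) (s x : R) :
  p`_0 = 0 -> 0 <= s -> s <= x -> 0 < x ->
  pnorm s p <= `|p`_1| * s + (s / x) ^+ 2 * pnorm x p.
Proof.
move=> p0 s0 sx xp.
have x0 := ltW xp.
have sz : (size p <= (size p).+2)%N by rewrite -addn2 leq_addr.
rewrite (pnormE s sz) (pnormE x sz).
do 2 (rewrite big_ord_recl /=); rewrite p0 normr0 mul0r add0r expr1 lerD2l.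
apply: (@le_trans _ _ ((s / x) ^+ 2 * \sum_(i < size p)
    `|p`_(bump 0 (bump 0 i))| * x ^+ bump 0 (bump 0 i))).
  rewrite big_distrr /= ler_sum// => i _; rewrite /bump /= !add1n.
  rewrite [leRHS]mulrCA ler_wpM2l// -addn2 !exprD [leRHS]mulrCA expr_div_n.
  rewrite divfK ?expf_neq0 ?gt_eqF// ler_wpM2r ?exprn_ge0//.
  by rewrite lerXn2r ?nnegrE.
rewrite ler_wpM2l ?exprn_ge0 ?divr_ge0//.
do 2 (rewrite big_ord_recl /=).
by rewrite p0 normr0 mul0r add0r lerDr mulr_ge0// exprn_ge0.
Qed.

(** * Polynomial approximations of the inverse of [x * q(x)^(1-t)] *)

(* [l] approximates [ln q]; the variables are scaled by [t]: if
   [y = t x q(x)^(1-t)] then [t x] is approximated by the value at [y]. *)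
Fixpoint inv_poly (R : fieldType) N (l : {poly R}) (t : R) n : {poly R} :=
  if n is n.+1 then
    'X * (exp_poly R N \Po ((t - 1) *: (l \Po (t^-1 *: inv_poly N l t n))))
  else 0.

(** The last hypothesis makes each iteration preserve the bound [u] on the norm, so the estimate
    does not depend on [n] or [N]. Its exponent is [t] times the estimate of
    [pnorm_le_linear_quadratic] at [s = u / t]. *)
Lemma pnorm_inv_poly (R : realType) N (l : {poly R}) (V C x t r u : R) n :
  l`_0 = 0 -> `|l`_1| <= V -> pnorm x l <= C -> 0 < x -> 1 < t ->
  0 <= r -> 0 <= u -> u / t <= x ->
  r * expR (V * u + C * u ^+ 2 / x ^+ 2 / t) <= u ->
  pnorm r (inv_poly N l t n) <= u.
Proof.
move=> l0 l1 lC x0 t1 r0 u0 utx ru.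
have t0 : 0 < t by lra.
have V0 : 0 <= V by rewrite (le_trans _ l1).
have C0 : 0 <= C by rewrite (le_trans _ lC) ?pnorm_ge0 ?ltW.
elim: n => [|n IH] /=; first by rewrite pnorm0.
set U := inv_poly _ _ _ _ in IH *.
apply: le_trans (pnormM r0 _ _) _; rewrite pnormX; apply: le_trans ru.
rewrite ler_wpM2l//; apply: le_trans (pnorm_comp _ _ r0) _.
apply: le_trans (pnorm_exp_poly _ (pnorm_ge0 r0 _)) _.
rewrite ler_expR (pnormZ _ (t - 1)) ger0_norm ?subr_ge0 ?(ltW t1)//.
have ut0 : 0 <= u / t by rewrite divr_ge0// ltW.
have lb : pnorm r (l \Po (t^-1 *: U)) <= V * (u / t) + (u / t / x) ^+ 2 * C.
  apply: le_trans (pnorm_comp _ _ r0) _.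
  rewrite (pnormZ _ t^-1) ger0_norm ?invr_ge0 ?(ltW t0)// mulrC.
  apply: (@le_trans _ _ (pnorm (u / t) l)).
    apply: ler_pnorm; first by rewrite mulr_ge0 ?pnorm_ge0// invr_ge0 ltW.
    by rewrite ler_wpM2r// invr_ge0 ltW.
  apply: le_trans (pnorm_le_linear_quadratic l0 ut0 utx x0) _.
  by rewrite lerD ?ler_wpM2r// ler_wpM2l// exprn_ge0// divr_ge0// ltW.
apply: (@le_trans _ _ (t * (V * (u / t) + (u / t / x) ^+ 2 * C))).
  apply: ler_pM => //; rewrite ?subr_ge0 ?(ltW t1) ?pnorm_ge0//.
  by rewrite lerBlDr lerDl.
rewrite le_eqVlt; apply/orP; left; apply/eqP; field.
by rewrite !gt_eqF.
Qed.

(** * Limit of the approximations as t tends to infinity *)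

(** Picard iterates of [T = X exp (V T)] with truncated exponential; for [V = 1] the formal solution
    is the exponential generating function of rooted labelled trees. *)
Fixpoint tree_poly (R : fieldType) N (V : R) n : {poly R} :=
  if n is n.+1 then 'X * (exp_poly R N \Po (V *: tree_poly N V n)) else 0.

Section CoefLimits.
Variable R : realType.
Implicit Types (u v : R -> {poly R}) (p q r l : {poly R}).

Definition coef_cvg u p := forall j, (u t)`_j @[t --> +oo] --> p`_j.

Lemma coef_cvg_cst p : coef_cvg (fun=> p) p.
Proof. by move=> j; exact: cvg_cst. Qed.

Lemma coef_cvgD u v p q :
  coef_cvg u p -> coef_cvg v q -> coef_cvg (fun t => u t + v t) (p + q).
Proof.
move=> up vq j; rewrite coefD.
under eq_fun do rewrite coefD.
exact: cvgD.
Qed.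

Lemma coef_cvgM u v p q :
  coef_cvg u p -> coef_cvg v q -> coef_cvg (fun t => u t * v t) (p * q).
Proof.
move=> up vq j; rewrite coefM.
under eq_fun do rewrite coefM.
by apply: cvg_big => [|i _]; [exact: add_continuous|exact: cvgM].
Qed.

Lemma coef_cvgZ (a : R -> R) (b : R) u p : a t @[t --> +oo] --> b ->
  coef_cvg u p -> coef_cvg (fun t => a t *: u t) (b *: p).
Proof.
move=> ab up j; rewrite coefZ.
under eq_fun do rewrite coefZ.
exact: cvgM.
Qed.

Lemma coef_cvg_comp r u p :
  coef_cvg u p -> coef_cvg (fun t => r \Po u t) (r \Po p).
Proof.
move=> up; elim/poly_ind: r => [|r c IH].
  under eq_fun do rewrite comp_poly0.
  by rewrite comp_poly0; exact: coef_cvg_cst.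
under eq_fun do rewrite comp_polyD comp_polyM comp_polyX comp_polyC.
rewrite comp_polyD comp_polyM comp_polyX comp_polyC.
by apply: coef_cvgD; [exact: coef_cvgM|exact: coef_cvg_cst].
Qed.

Lemma cvg_inv_pinfty : t^-1 @[t --> +oo] --> (0 : R).
Proof. by apply/gtr0_cvgV0; [exists 0|exact: cvg_id]. Qed.

(* The term of degree [i] is multiplied by [(t - 1) t^-i], which tends to [1] if
   [i = 1] and to [0] if [i >= 2]. *)
Lemma coef_cvg_rescale l u p : l`_0 = 0 -> coef_cvg u p ->
  coef_cvg (fun t => (t - 1) *: (l \Po (t^-1 *: u t))) (l`_1 *: p).
Proof.
move=> l0 up.
have [r lE] : exists r, l = 'X * ((l`_1)%:P + 'X * r).
  elim/poly_ind: l l0 => [|l c _].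
    by exists 0; rewrite coef0 mulr0 addr0 mulr0.
  rewrite coefD coefMX coefC /= add0r => ->.
  elim/poly_ind: l => [|l d _].
    by exists 0; rewrite mul0r addr0 coef0 !mulr0 addr0 mulr0.
  exists l; rewrite addr0 coefMX /= coefD coefMX coefC /= add0r.
  by rewrite mulrC (mulrC l) addrC.
have c1 : (t - 1) * t^-1 @[t --> +oo] --> (1 : R).
  have : 1 - t^-1 @[t --> +oo] --> (1 - 0 : R).
    by apply: cvgB; [exact: cvg_cst|exact: cvg_inv_pinfty].
  rewrite subr0; apply: cvg_trans; apply: near_eq_cvg; near=> t.
  by rewrite mulrBl mul1r divff// gt_eqF//; near: t; exact: nbhs_pinfty_gt.
have c0 : coef_cvg (fun t => t^-1 *: u t) (0 *: p).
  exact: coef_cvgZ cvg_inv_pinfty up.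
have := coef_cvgM (coef_cvgZ c1 up) (@coef_cvg_comp ((l`_1)%:P + 'X * r) _ _ c0).
rewrite scale1r scale0r.
rewrite comp_polyD comp_polyC comp_polyM comp_polyX mul0r addr0.
rewrite (mulrC p) mul_polyC.
rewrite (_ : (fun t => _) = (fun t => (t - 1) *: (l \Po (t^-1 *: u t))))//.
apply/funext => t.
by rewrite [in RHS]lE comp_polyM comp_polyX -scalerA -!scalerAl.
Unshelve. all: by end_near. Qed.

Lemma cvg_inv_poly N (l : {poly R}) n : l`_0 = 0 ->
  coef_cvg (fun t => inv_poly N l t n) (tree_poly N l`_1 n).
Proof.
move=> l0; elim: n => [|n IH] /=; first exact: coef_cvg_cst.
apply: coef_cvgM; first exact: coef_cvg_cst.
by apply: coef_cvg_comp; exact: coef_cvg_rescale.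
Qed.

End CoefLimits.

(** * Growth of the coefficients of the tree function *)

Section CoefOrder.
Variable R : numDomainType.
Implicit Types p q : {poly R}.

(** Nonnegativity is part of the relation because products are monotone only for nonnegative
    coefficients. *)
Definition coef_le p q := forall j, 0 <= p`_j <= q`_j.

Lemma coef_leM p p' q q' :
  coef_le p p' -> coef_le q q' -> coef_le (p * q) (p' * q').
Proof.
move=> pp qq j; rewrite !coefM; apply/andP; split.
  rewrite sumr_ge0// => i _; rewrite mulr_ge0//.
    by case/andP: (pp i).
  by case/andP: (qq (j - i)%N).
apply: ler_sum => i _.
have /andP[? ?] := pp i; have /andP[? ?] := qq (j - i)%N.
exact: ler_pM.
Qed.

Lemma coef_leZ (a : R) p q : 0 <= a -> coef_le p q -> coef_le (a *: p) (a *: q).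
Proof.
move=> a0 pq j; have /andP[? ?] := pq j.
by rewrite !coefZ mulr_ge0//= ler_wpM2l.
Qed.

Lemma coef_leX n p q : coef_le p q -> coef_le (p ^+ n) (q ^+ n).
Proof.
move=> pq; elim: n => [|n IH]; last by rewrite !exprS; exact: coef_leM.
by move=> j; rewrite !expr0 coef1 lexx andbT ler0n.
Qed.

Lemma coef_le_comp p p' q q' :
  coef_le p p' -> coef_le q q' -> coef_le (p \Po q) (p' \Po q').
Proof.
move=> pp qq.
set n := maxn (size p) (size p').
have E (r s : {poly R}) : (size r <= n)%N ->
    r \Po s = \sum_(i < n) r`_i *: s ^+ i.
  move=> rn; rewrite comp_polyE (big_ord_widen n (fun i => r`_i *: s ^+ i))//.
  rewrite big_mkcond; apply: eq_bigr => i _; case: ltnP => // ri.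
  by rewrite nth_default// scale0r.
rewrite !E ?leq_maxl ?leq_maxr// => j; rewrite !coef_sum.
have h (i : 'I_n) : 0 <= (p`_i *: q ^+ i)`_j <= (p'`_i *: q' ^+ i)`_j.
  have /andP[? ?] := pp i; have /andP[? ?] := coef_leX i qq j.
  by rewrite !coefZ mulr_ge0//= ler_pM.
apply/andP; split; first by rewrite sumr_ge0// => i _; case/andP: (h i).
by apply: ler_sum => i _; case/andP: (h i).
Qed.

End CoefOrder.

Section TreeGrowth.
Variable R : realType.

Lemma coef_le_exp_poly M N : (M <= N)%N ->
  coef_le (exp_poly R M) (exp_poly R N).
Proof.
move=> MN j; rewrite !coef_poly !ltnS.
have [jM|_] := leqP j M.
  rewrite (leq_trans jM)//=.
  by rewrite invr_ge0 ler0n lexx.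
by rewrite lexx /=; case: ifP => _ //; rewrite invr_ge0.
Qed.

(** Every operation of the recursion preserves [coef_le]. Thanks to this, a single index [N] can
    serve both as truncation order and as number of iterations. *)
Lemma coef_le_tree_poly M N (V : R) m n : 0 <= V -> (M <= N)%N -> (m <= n)%N ->
  coef_le (tree_poly M V m) (tree_poly N V n).
Proof.
move=> V0 MN; elim: m n => [|m IH] n.
  (* For [m = 0] the claim is nonnegativity of the coefficients, which takes its own induction on
     [n]. *)
  move=> _; elim: n => [|n IH] j; first by rewrite /= coef0 lexx.
  rewrite coef0 lexx /=.
  have cX : coef_le ('X : {poly R}) 'X by move=> i; rewrite coefX lexx ler0n.
  have cT : coef_le (tree_poly N V n) (tree_poly N V n).
    by move=> i; have /andP[_] := IH i; rewrite coef0 lexx andbT.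
  have /andP[h _] := coef_leM cX (coef_le_comp
    (coef_le_exp_poly (leqnn N)) (coef_leZ V0 cT)) j.
  exact: h.
case: n => // n mn /=; apply: coef_leM.
  by move=> i; rewrite coefX lexx ler0n.
apply: coef_le_comp; first exact: coef_le_exp_poly.
by apply: coef_leZ => //; exact: IH.
Qed.

Lemma coef0_tree_poly N (V : R) n : (tree_poly N V n)`_0 = 0.
Proof. by case: n => [|n] /=; rewrite ?coef0// coefXM. Qed.

Lemma coef1_tree_poly N (V : R) n : (tree_poly N V n.+1)`_1 = 1.
Proof.
rewrite /= coefXM /= coef_comp_0 ?coefZ ?coef0_tree_poly ?mulr0//.
by rewrite coef_poly /= invr1.
Qed.

Lemma bernoulli (v : R) n : 0 <= v -> 1 + n%:R * (v - 1) <= v ^+ n.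
Proof.
move=> v0; elim: n => [|n IH]; first by rewrite mul0r addr0 expr0.
rewrite exprS; apply: le_trans (ler_wpM2l v0 IH).
have : 0 <= n%:R * (v - 1) ^+ 2 by rewrite mulr_ge0 ?ler0n ?sqr_ge0.
rewrite -natr1; move: (n%:R) => a; nra.
Qed.

(** Truncated form of [exp v >= e v], the tangent line at [v = 1]: Bernoulli's inequality is applied
    to each [v^i], and the sum of [i / i!] up to [M + 1] is the truncated exponential of order [M]
    at [1], hence the shift of index. *)
Lemma exp_poly_ge_linear M (v : R) : 0 <= v ->
  v * (exp_poly R M).[1] <= (exp_poly R M.+1).[v].
Proof.
move=> v0.
have E N (x : R) : (exp_poly R N).[x] = \sum_(i < N.+1) i`!%:R^-1 * x ^+ i.
  exact: horner_poly.
apply: (@le_trans _ _ (\sum_(i < M.+2) i`!%:R^-1 * (1 + i%:R * (v - 1)))).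
  have -> : \sum_(i < M.+2) i`!%:R^-1 * (1 + i%:R * (v - 1)) =
      \sum_(i < M.+2) i`!%:R^-1
      + \sum_(i < M.+2) i`!%:R^-1 * i%:R * (v - 1) :> R.
    by rewrite -big_split /=; apply: eq_bigr => i _; rewrite mulrDr mulr1 mulrA.
  have E1 : (exp_poly R M).[1] = \sum_(i < M.+1) i`!%:R^-1.
    by rewrite E; apply: eq_bigr => i _; rewrite expr1n mulr1.
  rewrite -mulr_suml.
  have -> : \sum_(i < M.+2) i`!%:R^-1 * i%:R = (exp_poly R M).[1] :> R.
    rewrite E1 big_ord_recl mulr0 add0r; apply: eq_bigr => i _.
    by rewrite lift0 factS natrM invfM mulrAC mulVf ?mul1r.
  rewrite big_ord_recr /= -E1.
  have : 0 <= M.+1`!%:R^-1 :> R by rewrite invr_ge0.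
  by lra.
rewrite E ler_sum// => i _; rewrite ler_wpM2l ?invr_ge0//.
exact: bernoulli.
Qed.

Lemma cvg_exp_poly1 : (exp_poly R n).[1] @[n --> \oo] --> (expR 1 : R).
Proof.
have : series (exp_coeff (1 : R)) @ \oo --> (expR 1 : R).
  exact: is_cvg_series_exp_coeff.
rewrite -cvg_shiftS; apply: cvg_trans; apply: near_eq_cvg; near=> n.
rewrite /series /= big_mkord horner_poly.
by apply: eq_bigr => i _; rewrite mulrC.
Unshelve. all: by end_near. Qed.

Lemma geometric_unbounded (rho a b : R) : 1 < rho -> 0 < a ->
  exists n, b < rho ^+ n * a.
Proof.
move=> r1 a0.
have [n hn] : exists n : nat, b / a / (rho - 1) < n%:R.
  exists (Num.truncn `|b / a / (rho - 1)|).+1.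
  by rewrite (le_lt_trans (ler_norm _))// truncnS_gt.
have rp : 0 < rho - 1 by rewrite subr_gt0.
have := bernoulli n (ltW (lt_trans ltr01 r1)).
move: hn; rewrite ltr_pdivrMr// => hn bn.
by exists n; rewrite -ltr_pdivrMr//; lra.
Qed.

(* The formal solution of [T = X exp (V T)] has radius of convergence at most
   [1 / (e V)]: for [Y > 1 / (e V)], [T |-> Y exp (V T)] expands by a factor
   [> 1]. *)
Lemma tree_poly_coef_gt (V B : R) : 0 < V -> 0 < B -> B < expR 1 * V ->
  exists N j, (j < N)%N /\ B ^+ j < (tree_poly N V N)`_j.+1.
Proof.
move=> V0 B0 BV.
(* [B'] is the midpoint of [B] and [e V], so [Y = 1 / B'] lies strictly between [1 / (e V)] and
   [1 / B]: values at [Y] grow without bound, while coefficients at most [B^j] would keep them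
   bounded. *)
pose B' := (B + expR 1 * V) / 2.
have BB' : B < B' by rewrite /B'; lra.
have B'V : B' / V < expR 1 by rewrite ltr_pdivrMr// /B'; lra.
have B'0 : 0 < B' by lra.
have [M hM] : exists M, B' / V < (exp_poly R M).[1].
  have [M _ hM] : \forall n \near \oo, B' / V < (exp_poly R n).[1].
    exact: (cvgr_gt _ cvg_exp_poly1).
  by exists M; apply: hM => /=.
pose Y := B'^-1.
have Y0 : 0 < Y by rewrite invr_gt0.
pose rho := Y * V * (exp_poly R M).[1].
have rho1 : 1 < rho.
  move: hM; rewrite ltr_pdivrMr// => hM.
  by rewrite /rho -mulrA ltr_pdivlMl// mulr1 mulrC.
have grow n : rho ^+ n * Y <= (tree_poly M.+1 V n.+1).[Y].
  elim: n => [|n IH].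
    rewrite expr0 mul1r /= scaler0 comp_poly0r hornerM hornerX hornerC.
    by rewrite coef_poly /= invr1 mulr1.
  rewrite [tree_poly _ _ _.+2]/= -/(tree_poly M.+1 V n.+1) hornerM hornerX.
  rewrite horner_comp hornerZ.
  have T0 : 0 <= (tree_poly M.+1 V n.+1).[Y].
    by rewrite (le_trans _ IH)// mulr_ge0 ?exprn_ge0 ?(ltW Y0)//; lra.
  have := exp_poly_ge_linear M (mulr_ge0 (ltW V0) T0).
  move=> /(ler_wpM2l (ltW Y0)); apply: le_trans.
  rewrite exprS -mulrA; apply: (@le_trans _ _ (rho * (tree_poly M.+1 V n.+1).[Y])).
    by rewrite ler_wpM2l//; lra.
  by rewrite /rho le_eqVlt; apply/orP; left; apply/eqP; ring.
(* [Y / (1 - B * Y)] is the sum of the series of [B^j Y^(j+1)], which bounds the value at [Y] if the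
   coefficient of index [j + 1] is at most [B^j]. *)
have [n hn] := geometric_unbounded (Y / (1 - B * Y)) rho1 Y0.
have {hn} := lt_le_trans hn (grow n).
set T := tree_poly _ _ _; set d := size T => hT.
(* [N] dominates the truncation order and the number of iterations of [T], so that
   [coef_le_tree_poly] applies, and also its size, so that every index [j < d] satisfies [j < N]. *)
pose N := maxn (maxn M.+1 n.+1) d.
have BY1 : B * Y < 1 by rewrite ltr_pdivrMr// mul1r.
have [//|H] := pselect (exists N j, (j < N)%N /\ B ^+ j < (tree_poly N V N)`_j.+1).
exfalso; move: hT; apply/negP; rewrite -leNgt.
have TB j : (j < d)%N -> T`_j.+1 <= B ^+ j.
  move=> jd; have /andP[_] := @coef_le_tree_poly M.+1 N V n.+1 N (ltW V0)
    (leq_trans (leq_maxl _ _) (leq_maxl _ _))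
    (leq_trans (leq_maxr _ _) (leq_maxl _ _)) j.+1.
  move/le_trans; apply; rewrite leNgt; apply/negP => h; apply: H.
  by exists N, j; split => //; rewrite (leq_trans jd)// leq_maxr.
rewrite (@horner_coef_wide _ d.+1) ?leqnSn// big_ord_recl coef0_tree_poly mul0r.
rewrite add0r ler_pdivlMr ?subr_gt0//.
apply: (@le_trans _ _ ((\sum_(j < d) (B * Y) ^+ j) * Y * (1 - B * Y))).
  rewrite ler_wpM2r ?subr_ge0 ?(ltW BY1)// mulr_suml ler_sum// => j _.
  rewrite lift0 exprSr exprMn mulrA ler_wpM2r ?(ltW Y0)//.
  by rewrite ler_wpM2r ?exprn_ge0 ?(ltW Y0) ?TB.
rewrite mulrAC (mulrC _ (1 - _)) -(opprB (B * Y)) mulNr -subrX1 opprB.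
by rewrite ler_piMl ?(ltW Y0)// lerBlDr lerDl exprn_ge0// mulr_ge0 ?ltW.
Qed.

End TreeGrowth.

(** * Asymptotic expansions at the left of 0 *)

Section BigO.
Variable R : realType.
Implicit Types (f df g h u v : R -> R) (p : {poly R}).

Definition bigO N h :=
  exists C : R, \forall x \near 0^'-, `|h x| <= C * `|x| ^+ N.

Lemma eq_bigO N h g : (\forall x \near 0^'-, h x = g x) -> bigO N h -> bigO N g.
Proof.
move=> hg [C hC]; exists C.
by apply: filterS2 hg hC => x ->.
Qed.

Lemma bigOD N h g : bigO N h -> bigO N g -> bigO N (fun x => h x + g x).
Proof.
move=> [C hC] [D gD]; exists (C + D); apply: filterS2 hC gD => x hx gx.
by rewrite (le_trans (ler_normD _ _))// mulrDl lerD.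
Qed.

Lemma bigOM M N h g : bigO M h -> bigO N g -> bigO (M + N) (fun x => h x * g x).
Proof.
move=> [C hC] [D gD]; exists (C * D); apply: filterS2 hC gD => x hx gx.
by rewrite normrM exprD mulrACA ler_pM.
Qed.

Lemma bigO_cst (c : R) : bigO 0 (fun=> c).
Proof. by exists `|c|; apply: nearW => x; rewrite expr0 mulr1. Qed.

Lemma bigO_id : bigO 1 (fun x => x).
Proof. by exists 1; apply: nearW => x; rewrite mul1r expr1. Qed.

Lemma bigOZ N (c : R) h : bigO N h -> bigO N (fun x => c * h x).
Proof. by move=> hN; have := bigOM (bigO_cst c) hN. Qed.

Lemma bigOB N h g : bigO N h -> bigO N g -> bigO N (fun x => h x - g x).
Proof.
move=> hN gN; have := bigOD hN (bigOZ (-1) gN).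
by apply: eq_bigO; apply: nearW => x; rewrite mulN1r.
Qed.

Lemma leq_bigO M N h : (M <= N)%N -> bigO N h -> bigO M h.
Proof.
move=> MN [C hC]; exists `|C|.
have x1 : \forall x \near (0 : R)^'-, -1 < x by apply: nbhs_left_gt; rewrite ltrN10.
have x0 : \forall x \near (0 : R)^'-, x < 0 by exact: nbhs_left_lt.
apply: filterS3 hC x1 x0 => x hx x1 x0; rewrite (le_trans hx)//.
apply: (@le_trans _ _ (`|C| * `|x| ^+ N)).
  by rewrite ler_wpM2r ?exprn_ge0// ler_norm.
rewrite ler_wpM2l//; apply: ler_wiXn2l => //.
by rewrite ltr0_norm//; lra.
Qed.

Lemma bigO_divx N h : bigO N.+1 h -> bigO N (fun x => h x / x).
Proof.
move=> [C hC]; exists C.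
have x0 : \forall x \near (0 : R)^'-, x < 0 by exact: nbhs_left_lt.
apply: filterS2 hC x0 => x hx x0.
by rewrite normrM normfV ler_pdivrMr ?normr_gt0 ?lt_eqF// -mulrA -exprSr.
Qed.

(** Polynomials are Lipschitz on bounded sets. The Horner step is [p(u) u - p(v) v = (p(u) - p(v)) u
    + p(v) (u - v)]. *)
Lemma bigO_horner p u v N : bigO 0 u -> bigO 0 v ->
  bigO N (fun x => u x - v x) -> bigO N (fun x => p.[u x] - p.[v x]).
Proof.
move=> u0 v0 uv; elim/poly_ind: p => [|p c IH].
  apply: (@leq_bigO _ N) => //; exists 0; apply: nearW => x.
  by rewrite !horner0 subrr normr0 mul0r.
have pv : bigO 0 (fun x => p.[v x]).
  clear IH; elim/poly_ind: p => [|p d IH].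
    by apply: eq_bigO (bigO_cst 0); apply: nearW => x; rewrite horner0.
  apply: eq_bigO (bigOD (bigOM IH v0) (bigO_cst d)).
  by apply: nearW => x; rewrite !hornerE.
have h1 := bigOM IH u0; have h2 := bigOM pv uv.
rewrite addn0 in h1.
apply: eq_bigO (bigOD h1 h2); apply: nearW => x.
by rewrite !hornerE; ring.
Qed.

Lemma bigO_small h (e : R) : 0 < e -> bigO 1 h ->
  \forall x \near 0^'-, `|h x| < e.
Proof.
move=> e0 [C hC].
have x0 : \forall x \near (0 : R)^'-, x < 0 by exact: nbhs_left_lt.
have x1 : \forall x \near (0 : R)^'-, - (e / (`|C| + 1)) < x.
  by apply: nbhs_left_gt; rewrite oppr_lt0 divr_gt0// ltr_wpDl.
apply: filterS3 hC x0 x1 => x hx x0 x1.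
rewrite (le_lt_trans hx)// expr1 ltr0_norm//.
apply: (@le_lt_trans _ _ ((`|C| + 1) * - x)).
  by rewrite ler_wpM2r ?oppr_ge0 ?(ltW x0)// (le_trans (ler_norm _))// lerDl.
by rewrite mulrC -ltr_pdivlMr ?ltr_wpDl// ltrNl.
Qed.

(** Two-sided in [z], unlike [bigO], because [bigO_taylor] composes with functions whose sign is not
    controlled. *)
Definition taylor f p N := exists C d : R, 0 < d /\
  forall z, `|z| < d -> `|f z - p.[z]| <= C * `|z| ^+ N.

Lemma bigO_taylor f p N u : taylor f p N -> bigO 1 u ->
  bigO N (fun x => f (u x) - p.[u x]).
Proof.
move=> [C [d [d0 fC]]] u1; have [D uD] := u1.
exists (`|C| * `|D| ^+ N); apply: filterS2 (bigO_small d0 u1) uD => x ux uDx.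
apply: le_trans (fC _ ux) _; apply: (@le_trans _ _ (`|C| * `|u x| ^+ N)).
  by rewrite ler_wpM2r ?exprn_ge0// ler_norm.
rewrite -mulrA ler_wpM2l// -exprMn lerXn2r// ?nnegrE ?mulr_ge0//.
by rewrite (le_trans uDx)// expr1 ler_wpM2r// ler_norm.
Qed.

(** The mean value theorem between [0] and [z] raises the order of the error of the derivative by
    one and keeps the constant [C]. *)
Lemma taylor_step f df p (C d : R) N : 0 < d -> f 0 = p.[0] ->
  (forall z, `|z| < d -> is_derive z (1 : R) f (df z)) ->
  (forall z, `|z| < d -> `|df z - p^`().[z]| <= C * `|z| ^+ N) ->
  forall z, `|z| < d -> `|f z - p.[z]| <= C * `|z| ^+ N.+1.
Proof.
move=> d0 f0 fd dfC z zd.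
pose g y := f y - p.[y].
have gd y : `|y| < d -> is_derive y (1 : R) g (df y - p^`().[y]).
  move=> yd; have := fd y yd => ?.
  have : is_derive y (1 : R) (horner p) (p^`().[y]).
    by rewrite derivE derive1E; apply: DeriveDef => //; exact: derivable_horner.
  by move=> ?; rewrite /g; apply: is_deriveB.
have gc y : `|y| < d -> {for y, continuous g}.
  move=> yd; apply: differentiable_continuous; apply/derivable1_diffP.
  by have [] := gd y yd.
have C0 : 0 <= C * `|z| ^+ N by rewrite (le_trans _ (dfC z zd)).
have key a b c : g b - g a = (df c - p^`().[c]) * (b - a) -> `|c| < d ->
    `|c| <= `|z| -> `|b - a| = `|z| -> `|g b - g a| <= C * `|z| ^+ N.+1.
  move=> -> cd cz baz; rewrite normrM baz exprSr mulrA ler_wpM2r//.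
  apply: le_trans (dfC _ cd) _.
  (* The sign of [C] is not given: it follows from [C0] unless [z ^+ N] vanishes, and then [z = 0]
     forces [|c| = |z|]. *)
  have [N0|zN0] := eqVneq (`|z| ^+ N) 0.
    have z0 : `|z| = 0 by apply/eqP; move/eqP: N0; rewrite expf_eq0 => /andP[].
    have -> : `|c| = `|z| by apply/eqP; rewrite eq_le cz z0 normr_ge0.
    by [].
  rewrite ler_wpM2l// ?lerXn2r ?nnegrE//.
  by rewrite -(pmulr_lge0 _ (_ : 0 < `|z| ^+ N))// lt_neqAle eq_sym zN0 exprn_ge0.
have g0 : g 0 = 0 by rewrite /g f0 subrr.
rewrite -/(g z).
have [z0|z0] := leP 0 z.
  have [||c + gE] := @MVT_segment _ g (fun y => df y - p^`().[y]) 0 z z0.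
  - move=> y; rewrite in_itv /= => /andP[y0 yz]; apply: gd.
    by rewrite ger0_norm ?(ltW y0)// (lt_le_trans yz)// (le_trans (ler_norm _))// ltW.
  - apply: continuous_in_subspaceT => y; rewrite inE /= in_itv /= => /andP[y0 yz].
    by apply: gc; rewrite ger0_norm// (le_lt_trans yz)// (le_lt_trans (ler_norm _)).
  rewrite in_itv /= => /andP[c0 cz].
  have cz' : `|c| <= `|z| by rewrite !ger0_norm.
  have := key 0 z c gE (le_lt_trans cz' zd) cz'.
  by rewrite g0 !subr0; apply.
have [||c + gE] := @MVT_segment _ g (fun y => df y - p^`().[y]) z 0 (ltW z0).
- move=> y; rewrite in_itv /= => /andP[zy y0]; apply: gd.
  by rewrite ltr0_norm// (lt_trans _ zd)// ltr0_norm// ltrN2.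
- apply: continuous_in_subspaceT => y; rewrite inE /= in_itv /= => /andP[zy y0].
  by apply: gc; rewrite ler0_norm// (le_lt_trans _ zd)// ltr0_norm// lerN2.
rewrite in_itv /= => /andP[zc c0].
have cz' : `|c| <= `|z| by rewrite ler0_norm// ltr0_norm// lerN2.
have := key z 0 c gE (le_lt_trans cz' zd) cz'.
by rewrite g0 !sub0r !normrN; apply.
Qed.

Lemma taylor_expR N : taylor expR (exp_poly R N) N.+1.
Proof.
have e0 M : expR 0 = (exp_poly R M).[0].
  by rewrite expR0 horner_coef0 coef_poly /= invr1.
exists (expR 1), 1; split=> //; elim: N => [|N IH].
  apply: (@taylor_step _ expR) => // z z1.
  have -> : (exp_poly R 0)^`() = 0.
    by apply/polyP => i; rewrite coef_deriv coef_poly /= coef0 mul0rn.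
  rewrite horner0 subr0 expr0 mulr1 ger0_norm ?expR_ge0// ler_expR.
  by rewrite (le_trans (ler_norm _))// ltW.
apply: (@taylor_step _ expR) => // z z1.
suff -> : (exp_poly R N.+1)^`() = exp_poly R N by exact: IH.
apply/polyP => i; rewrite coef_deriv !coef_poly !ltnS; case: ifP => _.
  by rewrite -[_^-1 *+ _]mulr_natr factS natrM invfM mulrAC mulVf ?mul1r.
by rewrite mul0rn.
Qed.

(** The derivative of [log_poly] is a truncated geometric series for [1 / (1 + z)], with exact
    remainder [(-z)^N / (1 + z)], at most [2 |z|^N] in absolute value for [|z| < 1/2]. *)
Lemma taylor_ln N : taylor (fun z => ln (1 + z)) (log_poly R N) N.+1.
Proof.
exists 2, 2^-1; split; first by rewrite invr_gt0.
apply: (@taylor_step _ (fun z => (1 + z)^-1)); first by rewrite invr_gt0.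
- by rewrite addr0 ln1 horner_coef0 coef_poly /= invr0 mulr0.
- move=> z zd; have z1 : 0 < 1 + z.
    by move: zd; rewrite ltr_norml => /andP[? ?]; lra.
  have h1 := is_derive1_ln z1.
  have h2 : is_derive z 1 (fun y : R => 1 + y) 1.
    by rewrite -[X in is_derive _ _ _ X]add0r; apply: is_deriveD.
  by have := is_derive1_comp h1 h2; rewrite mulr1.
move=> z zd.
have z1 : 2^-1 <= 1 + z.
  by move: zd; rewrite ltr_norml => /andP[? ?]; lra.
have -> : (log_poly R N)^`() = \poly_(i < N) (-1) ^+ i.
  apply/polyP => i; rewrite coef_deriv !coef_poly ltnS; case: ifP => _.
    by rewrite -[_ *+ i.+1]mulr_natr -mulrA mulVf ?pnatr_eq0// mulr1 !exprS mulrA mulrNN !mul1r.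
  by rewrite mul0rn.
have z0 : 1 + z != 0 by rewrite gt_eqF//; lra.
have -> : (1 + z)^-1 - (\poly_(i < N) (-1) ^+ i).[z] = (- z) ^+ N / (1 + z).
  have -> : (\poly_(i < N) (-1) ^+ i).[z] = \sum_(i < N) (- z) ^+ i.
    by rewrite horner_poly; apply: eq_bigr => i _; rewrite [RHS]exprNn.
  have := subrX1 (- z) N => /(canRL (subrK 1)) ->.
  by field.
rewrite normrM normrX normrN normfV mulrC ler_wpM2r ?exprn_ge0//.
rewrite ger0_norm; last by lra.
by rewrite invf_ple ?posrE//; lra.
Qed.

End BigO.

(** * Inversion of [x * q(x)^(1-t)] up to any order *)

Section Inversion.
Variables (R : realType) (m : nat -> R) (f : R -> R).
Hypotheses (m0 : m 0%N = 1) (m1 : m 1%N = 1).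
Hypothesis fE : forall N, bigO N.+1 (fun x => f x - (series_poly m N).[x]).

Let q x := f x / (1 + f x) / x.

Lemma bigO_horner0 (p : {poly R}) : p`_0 = 0 -> bigO 1 (fun x => p.[x]).
Proof.
move=> p0; have h : bigO 1 (fun x : R => x - 0).
  by apply: eq_bigO (@bigO_id R); apply: nearW => x; rewrite subr0.
have := bigO_horner p (leq_bigO (leq0n 1) (@bigO_id R)) (bigO_cst 0) h.
by apply: eq_bigO; apply: nearW => x; rewrite horner_coef0 p0 subr0.
Qed.

Lemma mulX_series_poly N :
  'X * (1 + series_poly (fun i => m i.+1) N) = series_poly m N.+1.
Proof.
apply/polyP => i; rewrite coefXM coef_series_poly//.
case: i => [|i]//=; rewrite coefD coef1 coef_series_poly// ltnS.
by case: i => [|i] /=; rewrite ?addr0 ?m1// add0r.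
Qed.

Lemma bigO_f : bigO 1 f.
Proof.
have p0 : (series_poly m 0)`_0 = 0 by rewrite coef_series_poly.
apply: eq_bigO (bigOD (fE 0) (bigO_horner0 p0)).
by apply: nearW => x; rewrite subrK.
Qed.

Lemma bigO_fx N :
  bigO N.+1 (fun x => f x / x - 1 - (series_poly (fun i => m i.+1) N).[x]).
Proof.
apply: eq_bigO (bigO_divx (fE N.+1)).
have x0 : \forall x \near (0 : R)^'-, x < 0 by exact: nbhs_left_lt.
apply: filterS x0 => x x0.
rewrite -mulX_series_poly hornerM hornerX hornerD hornerC.
by field; rewrite lt_eqF.
Qed.

(** Both [f x / x] and [1 + f x] are [1 + O(x)], hence positive near [0], so the logarithm of their
    quotient [q x] splits and each part is expanded by [taylor_ln]. *)
Lemma log_ratio_expansion N :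
  bigO N.+1 (fun x => ln (q x) - (log_ratio_poly m N).[x]).
Proof.
have lnE u (p : {poly R}) : bigO 1 u -> p`_0 = 0 ->
    bigO N.+1 (fun x => u x - p.[x]) ->
    bigO N.+1 (fun x => ln (1 + u x) - (log_poly R N \Po p).[x]).
  move=> u1 p0 up.
  have u0 := leq_bigO (leq0n 1) u1.
  have p0' := leq_bigO (leq0n 1) (bigO_horner0 p0).
  apply: eq_bigO (bigOD (bigO_taylor (taylor_ln R N) u1)
    (bigO_horner (log_poly R N) u0 p0' up)).
  by apply: nearW => x; rewrite horner_comp addrA subrK.
have a1 : bigO 1 (fun x => f x / x - 1).
  have p0 : (series_poly (fun i => m i.+1) 0)`_0 = 0 by rewrite coef_series_poly.
  apply: eq_bigO (bigOD (bigO_fx 0) (bigO_horner0 p0)).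
  by apply: nearW => x; rewrite subrK.
have pa0 : (series_poly (fun i => m i.+1) N)`_0 = 0 by rewrite coef_series_poly.
have pb0 : (series_poly m N)`_0 = 0 by rewrite coef_series_poly.
apply: eq_bigO (bigOB (lnE _ _ a1 pa0 (bigO_fx N)) (lnE _ _ bigO_f pb0 (fE N))).
have e2 : 0 < 2^-1 :> R by rewrite invr_gt0.
have x0 : \forall x \near (0 : R)^'-, x < 0 by exact: nbhs_left_lt.
apply: filterS3 (bigO_small e2 a1) (bigO_small e2 bigO_f) x0 => x ax fx x0.
have ap : 0 < f x / x.
  by move: ax; rewrite ltr_norml => /andP[? _]; lra.
have fp : 0 < 1 + f x.
  by move: fx; rewrite ltr_norml => /andP[? _]; lra.
have -> : q x = f x / x / (1 + f x) by rewrite /q mulrAC.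
have -> : 1 + (f x / x - 1) = f x / x by ring.
by rewrite (ln_div ap fp) hornerD hornerN; ring.
Qed.

Lemma bigO_ln_q : bigO 1 (fun x => ln (q x)).
Proof.
have p0 := @coef_log_ratio_poly_0 R m 0 m0 m1.
apply: eq_bigO (bigOD (log_ratio_expansion 0) (bigO_horner0 p0)).
by apply: nearW => x; rewrite subrK.
Qed.

Variable t : R.
Hypothesis t1 : 1 < t.

Let k x := x * expR ((1 - t) * ln (q x)).
Let g x := expR ((t - 1) * ln (q x)).

Lemma kg x : k x * g x = x.
Proof.
rewrite /k /g -mulrA -expRD -mulrDl (_ : 1 - t + (t - 1) = 0); last by ring.
by rewrite mul0r expR0 mulr1.
Qed.

Lemma bigO_expR (u : R -> R) : bigO 1 u -> bigO 0 (fun x => expR (u x)).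
Proof.
move=> u1; exists (expR 1); apply: filterS (bigO_small ltr01 u1) => x ux.
rewrite expr0 mulr1 ger0_norm ?expR_ge0// ler_expR.
by rewrite (le_trans (ler_norm _))// ltW.
Qed.

Lemma bigO_k : bigO 1 k.
Proof. by have := bigOM (@bigO_id R) (bigO_expR (bigOZ (1 - t) bigO_ln_q)). Qed.

(** By [kg], [g x] is the quotient of [x] by [k x], and it is bounded. Together with [bigO_k] this
    makes orders in [x] and in [k x] equivalent. *)
Lemma k_lower : exists2 C : R, 0 < C & \forall x \near 0^'-, `|x| <= C * `|k x|.
Proof.
have [C gC] := bigO_expR (bigOZ (t - 1) bigO_ln_q).
exists (`|C| + 1); first by rewrite ltr_wpDl.
apply: filterS gC => x gx; rewrite -{1}(kg x) normrM mulrC ler_wpM2r//.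
by rewrite (le_trans gx)// expr0 mulr1 (le_trans (ler_norm _))// lerDl.
Qed.

(** By [kg], [x] solves the fixed-point equation [x = k x * g x]. Each iteration replaces [g] by its
    expansion [G], and the factor [k x = O(x)] gains one order. *)
Lemma inv_poly_expansion N n : (n <= N)%N ->
  bigO n.+1 (fun x =>
    x - t^-1 * (inv_poly N (log_ratio_poly m N) t n).[t * k x]).
Proof.
set l := log_ratio_poly m N.
have t0 : t != 0 by rewrite gt_eqF// (lt_trans ltr01 t1).
have l0 : l`_0 = 0 by rewrite coef_log_ratio_poly_0.
pose G := exp_poly R N \Po ((t - 1) *: l).
have gG : bigO N.+1 (fun x => g x - G.[x]).
  have w1 := bigOZ (t - 1) bigO_ln_q.
  have wl : bigO N.+1 (fun x => (t - 1) * ln (q x) - (t - 1) * l.[x]).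
    apply: eq_bigO (bigOZ (t - 1) (log_ratio_expansion N)).
    by apply: nearW => x; rewrite mulrBr.
  have l1 := bigOZ (t - 1) (bigO_horner0 l0).
  apply: eq_bigO (bigOD (bigO_taylor (taylor_expR R N) w1)
    (bigO_horner (exp_poly R N) (leq_bigO (leq0n 1) w1)
      (leq_bigO (leq0n 1) l1) wl)).
  by apply: nearW => x; rewrite /G horner_comp hornerZ addrA subrK.
elim: n => [_|n IH nN].
  apply: eq_bigO (@bigO_id R); apply: nearW => x /=.
  by rewrite horner0 mulr0 subr0.
have {}IH := IH (ltnW nN).
set U := inv_poly N l t n in IH *.
have U0 : bigO 0 (fun x => t^-1 * U.[t * k x]).
  have := bigOB (leq_bigO (leq0n 1) (@bigO_id R)) (leq_bigO (leq0n _) IH).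
  by apply: eq_bigO; apply: nearW => x; ring.
have h := bigO_horner G (leq_bigO (leq0n 1) (@bigO_id R)) U0 IH.
have := bigOM bigO_k (bigOD (leq_bigO (_ : n < N.+1)%N gG) h).
rewrite add1n; move=> /(_ (ltnW nN)); apply: eq_bigO; apply: nearW => x.
rewrite [inv_poly _ _ _ _]/= -/U hornerM hornerX.
rewrite addrA subrK mulrBr kg; congr (x - _).
by rewrite /G !horner_comp !hornerZ horner_comp hornerZ !mulrA mulVf// mul1r.
Qed.

Lemma f_expansion N :
  bigO N.+1 (fun x => f x -
    (series_poly m N \Po
      (t^-1 *: inv_poly N (log_ratio_poly m N) t N)).[t * k x]).
Proof.
have h := inv_poly_expansion (leqnn N).
have U0 : bigO 0
    (fun x => t^-1 * (inv_poly N (log_ratio_poly m N) t N).[t * k x]).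
  have := bigOB (leq_bigO (leq0n 1) (@bigO_id R)) (leq_bigO (leq0n _) h).
  by apply: eq_bigO; apply: nearW => x; ring.
have := bigOD (fE N)
  (bigO_horner (series_poly m N) (leq_bigO (leq0n 1) (@bigO_id R)) U0 h).
apply: eq_bigO; apply: nearW => x.
by rewrite addrA subrK horner_comp hornerZ.
Qed.

End Inversion.

(** * Moments and the psi-transform *)

Section Moments.
Variables (R : realType) (P : probability (measurableTypeR R) R).

Local Notation D := (`[0, +oo[%classic : set (measurableTypeR R)).

Definition moment n : \bar R := (\int[P]_(s in D) (s ^+ n)%:E)%E.

(** Multiplied by [y^n], this is the remainder of order [n] in [psi_expansion]. For [y < 0] the
    denominator absorbs one power of [s], so finiteness of the moment of order [n] already gives
    finiteness at order [n + 1]. *)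
Definition damped_moment n (y : R) : \bar R :=
  (\int[P]_(s in D) (s ^+ n / (1 - y * s))%:E)%E.

Lemma itv0y_ge0 (s : R) : D s -> 0 <= s.
Proof. by rewrite /= in_itv /= andbT. Qed.

Lemma measurable_itv0y : measurable D.
Proof. exact: measurable_itv. Qed.

Lemma denom_gt0 (y s : R) : y <= 0 -> D s -> 0 < 1 - y * s.
Proof. by move=> y0 /itv0y_ge0 s0; rewrite subr_gt0 (le_lt_trans _ ltr01)// mulr_le0_ge0. Qed.

Lemma measurable_moment n : measurable_fun D (fun s : R => (s ^+ n)%:E).
Proof. by apply/measurable_EFinP; exact: measurable_funX. Qed.

Lemma measurable_damped n y : y <= 0 ->
  measurable_fun D (fun s : R => (s ^+ n / (1 - y * s))%:E).
Proof.
move=> y0; apply/measurable_EFinP.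
apply: subspace_continuous_measurable_fun; first exact: measurable_itv0y.
apply: continuous_in_subspaceT => s; rewrite inE => Ds.
apply: cvgM; first exact: exprn_continuous.
apply: cvgV; first by rewrite gt_eqF// denom_gt0.
by apply: cvgB; [exact: cvg_cst|apply: cvgM; [exact: cvg_cst|exact: cvg_id]].
Qed.

Lemma moment_ge0 n : (0 <= moment n)%E.
Proof. by apply: integral_ge0 => s /itv0y_ge0 s0; rewrite lee_fin exprn_ge0. Qed.

Lemma damped_ge0 n y s : y <= 0 -> D s -> 0 <= s ^+ n / (1 - y * s).
Proof.
by move=> y0 Ds; rewrite divr_ge0 ?exprn_ge0 ?(itv0y_ge0 Ds)// ltW// denom_gt0.
Qed.

Lemma damped_moment_ge0 n y : y <= 0 -> (0 <= damped_moment n y)%E.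
Proof. by move=> y0; apply: integral_ge0 => s Ds; rewrite lee_fin damped_ge0. Qed.

(** Integrates [s^n = (s^n - y s^(n+1)) / (1 - y s)]; both parts are nonnegative, so infinite values
    are allowed. *)
Lemma momentE n y : y <= 0 ->
  moment n = (damped_moment n y + (- y)%:E * damped_moment n.+1 y)%E.
Proof.
move=> y0.
have ge0 k s : D s -> (0 <= (s ^+ k / (1 - y * s))%:E)%E.
  by move=> Ds; rewrite lee_fin damped_ge0.
have ny : (0 <= (- y)%:E)%E by rewrite lee_fin oppr_ge0.
rewrite /moment /damped_moment.
rewrite -(ge0_integralZl P measurable_itv0y (measurable_damped n.+1 y0) (ge0 _) ny).
rewrite -(ge0_integralD P measurable_itv0y (ge0 n) (measurable_damped n y0)); last 2 first.
- by move=> s Ds; rewrite mule_ge0// ge0.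
- apply: emeasurable_funM; first exact: measurable_cst.
  exact: measurable_damped.
apply: eq_integral => s; rewrite inE => Ds.
rewrite -EFinM -EFinD; congr (_%:E).
have := denom_gt0 y0 Ds => h; rewrite exprS; field.
by rewrite gt_eqF.
Qed.

Lemma damped_le_moment n y : y <= 0 -> (damped_moment n y <= moment n)%E.
Proof.
move=> y0; rewrite (momentE n y0) leeDl// mule_ge0 ?damped_moment_ge0//.
by rewrite lee_fin oppr_ge0.
Qed.

Hypothesis P_nonneg : on_nonneg P.

Lemma moment0 : moment 0 = 1%E.
Proof.
rewrite /moment; under eq_integral do rewrite expr0.
rewrite integral_cst ?mul1e//; exact: measurable_itv0y.
Qed.

Lemma damped_moment0_fin y : y <= 0 -> damped_moment 0 y \is a fin_num.
Proof.
move=> y0; rewrite ge0_fin_numE ?damped_moment_ge0//.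
by rewrite (le_lt_trans (damped_le_moment 0 y0))// moment0 ltry.
Qed.

Lemma damped_momentS_fin n y : y < 0 -> moment n \is a fin_num ->
  damped_moment n.+1 y \is a fin_num.
Proof.
move=> y0; rewrite (momentE n (ltW y0)) fin_numD => /andP[_].
have := damped_moment_ge0 n.+1 (ltW y0).
case: (damped_moment n.+1 y) => //=.
by rewrite gt0_muley// lte_fin oppr_gt0.
Qed.

Lemma damped_momentE n y : y < 0 -> moment n \is a fin_num ->
  fine (damped_moment n y) = fine (moment n) + y * fine (damped_moment n.+1 y).
Proof.
move=> y0 mn; have := damped_momentS_fin y0 mn.
have : damped_moment n y \is a fin_num.
  rewrite ge0_fin_numE ?damped_moment_ge0 ?(ltW y0)//.
  by rewrite (le_lt_trans (damped_le_moment n (ltW y0)))// ltey_eq mn.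
rewrite (momentE n (ltW y0)).
case: (damped_moment n y) => // a _; case: (damped_moment n.+1 y) => // b _ /=.
by ring.
Qed.

Lemma psiE y : y < 0 -> 1 + psi P y = fine (damped_moment 0 y).
Proof.
move=> y0; rewrite damped_momentE ?moment0//= /psi /Rintegral.
congr (1 + _).
have -> : (\int[P]_(s in D) (y * s / (1 - y * s))%:E =
    \int[P]_(s in D) (- ((- y)%:E * (s ^+ 1 / (1 - y * s))%:E)))%E.
  apply: eq_integral => s _; rewrite -EFinM -EFinN expr1; congr (_%:E); ring.
have J1 : damped_moment 1 y \is a fin_num.
  by rewrite damped_momentS_fin// moment0.
rewrite integral_ge0N//; last first.
  by move=> s Ds; rewrite -EFinM lee_fin mulr_ge0 ?damped_ge0 ?oppr_ge0 ?ltW.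
have ge0 s : D s -> (0 <= (s ^+ 1 / (1 - y * s))%:E)%E.
  by move=> Ds; rewrite lee_fin damped_ge0 ?ltW.
have ny : (0 <= (- y)%:E)%E by rewrite lee_fin oppr_ge0 ltW.
rewrite (ge0_integralZl P measurable_itv0y (measurable_damped 1 (ltW y0)) ge0 ny).
rewrite -/(damped_moment 1 y); move: J1; case: (damped_moment 1 y) => //= a _.
by ring.
Qed.

Lemma psi_expansion n y : y < 0 -> (forall i, (i < n)%N -> moment i \is a fin_num) ->
  1 + psi P y = \sum_(i < n) fine (moment i) * y ^+ i
    + y ^+ n * fine (damped_moment n y).
Proof.
move=> y0; elim: n => [_|n IH mn].
  by rewrite big_ord0 add0r expr0 mul1r psiE.
rewrite IH; last by move=> i /ltnW; exact: mn.
rewrite big_ord_recr /= damped_momentE ?mn// exprSr; ring.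
Qed.

End Moments.

(** * Moments read off an asymptotic expansion along [k x] *)

Section MomentsOfExpansion.
Variables (R : realType) (P : probability (measurableTypeR R) R).
Hypothesis P_nonneg : on_nonneg P.
Variable k : R -> R.
Hypothesis k_lt0 : \forall x \near 0^'-, k x < 0.
Hypothesis k_O : bigO 1 k.
Hypothesis k_lower :
  exists2 C : R, 0 < C & \forall x \near 0^'-, `|x| <= C * `|k x|.

Lemma bigO_cvg0 (h : R -> R) : bigO 1 h -> h x @[x --> 0^'-] --> 0.
Proof.
move=> h1; apply/cvgr0Pnorm_lt => e e0; exact: bigO_small.
Qed.

Lemma bigO_div_k (h : R -> R) j : bigO j.+1 (fun x => k x ^+ j * h x) -> bigO 1 h.
Proof.
move=> [C hC]; have [D D0 kD] := k_lower; exists (C * D ^+ j).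
near=> x.
have hx : `|k x ^+ j * h x| <= C * `|x| ^+ j.+1 by near: x.
have xk : `|x| <= D * `|k x| by near: x.
have kx0 : k x < 0 by near: x.
have x0 : x < 0 by near: x; exact: nbhs_left_lt.
have kp : 0 < `|k x| ^+ j by rewrite exprn_gt0// normr_gt0 lt_eqF.
have xp : 0 < `|x| by rewrite normr_gt0 lt_eqF.
have C0 : 0 <= C.
  by rewrite -(pmulr_lge0 _ (exprn_gt0 j.+1 xp)) (le_trans _ hx).
rewrite -(ler_pM2l kp) expr1 -normrX -normrM (le_trans hx)//.
rewrite exprSr normrX mulrA.
rewrite (_ : _ * (C * D ^+ j * `|x|) = C * (D * `|k x|) ^+ j * `|x|); last first.
  by rewrite exprMn; ring.
by rewrite ler_wpM2r// ler_wpM2l// lerXn2r ?nnegrE// mulr_ge0// ltW.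
Unshelve. all: by end_near. Qed.

(* Fatou's lemma gives [<=], and [damped_le_moment] gives [>=]. *)
Lemma moment_limit j (a : R) : (forall y, y < 0 -> damped_moment P j y \is a fin_num) ->
  bigO 1 (fun x => fine (damped_moment P j (k x)) - a) ->
  moment P j = a%:E.
Proof.
move=> Jfin h.
have [e /= e0 ke] := k_lt0.
(* Fatou's lemma is applied along a sequence; the denominator [n + 2] keeps [|x n| < e] strictly
   from [n = 0] on, so that [k (x n) < 0] always. *)
pose x n : R := - (e / n.+2%:R).
have n20 n : 0 < n.+2%:R :> R by rewrite ltr0n.
have xlt n : x n < 0 by rewrite oppr_lt0 divr_gt0.
have kx n : k (x n) < 0.
  apply: ke => /=; last exact: xlt.
  rewrite sub0r normrN normrN gtr0_norm ?divr_gt0// ltr_pdivrMr//.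
  by rewrite ltr_pMr// ltr1n.
have xcvg : x n @[n --> \oo] --> 0.
  rewrite -oppr0; apply: cvgN.
  rewrite -[X in _ --> X](mulr0 e); apply: cvgM; first exact: cvg_cst.
  by have := @cvg_harmonic R; rewrite -cvg_shiftS.
have seq (g : R -> R) (l : R) : g x @[x --> 0^'-] --> l -> g (x n) @[n --> \oo] --> l.
  by move=> /cvg_at_leftP; apply.
have kcvg : k (x n) @[n --> \oo] --> 0 by apply: seq; exact: bigO_cvg0.
have Jcvg : (fun n => damped_moment P j (k (x n))) @ \oo --> a%:E.
  apply: cvg_EFin; first by apply: nearW => n; exact: Jfin.
  apply/subr_cvg0.
  by apply: (seq (fun x => fine (damped_moment P j (k x)) - a)); exact: bigO_cvg0.
apply/eqP; rewrite eq_le; apply/andP; split.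
  have ge0 n (s : measurableTypeR R) : `[0, +oo[%classic s ->
      (0 <= (s ^+ j / (1 - k (x n) * s))%:E)%E.
    by move=> Ds; rewrite lee_fin damped_ge0 ?(ltW (kx n)).
  have := fatou P (@measurable_itv0y R)
    (fun n => measurable_damped j (ltW (kx n))) ge0.
  have [-> _] := cvg_limn_einf_sup Jcvg; apply: le_trans.
  rewrite le_eqVlt; apply/orP; left; apply/eqP; apply: eq_integral => s _.
  suff cv : (s ^+ j / (1 - k (x n) * s))%:E @[n --> \oo] --> (s ^+ j)%:E.
    by have [-> _] := cvg_limn_einf_sup cv.
  apply: cvg_EFin; first exact: nearW.
  have d1 : 1 - k (x n) * s @[n --> \oo] --> (1 - 0 * s : R).
    apply: cvgB; first exact: cvg_cst.
    by apply: cvgM => //; exact: cvg_cst.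
  rewrite mul0r subr0 in d1.
  have := cvgM (cvg_cst (s ^+ j : R)) (cvgV (@oner_neq0 R) d1).
  by rewrite invr1 mulr1; apply.
have : damped_moment P j (k (x n)) @[n --> \oo] --> a%:E by [].
move/cvge_to_le; apply; apply: nearW => n.
exact: damped_le_moment (ltW (kx n)).
Qed.

(** Strong induction on [j]: the terms of degree below [j] cancel, and division by [k x ^+ j] leaves
    the damped moment on one side and [drop_poly j p] on the other, whose value at [0] is the
    coefficient of index [j]. *)
Lemma moment_of_expansion N (p : {poly R}) :
  bigO N.+1 (fun x => 1 + psi P (k x) - p.[k x]) ->
  forall j, (j <= N)%N -> moment P j = (p`_j)%:E.
Proof.
move=> hp j; elim/ltn_ind: j => j IH jN.
have fin i : (i < j)%N -> moment P i \is a fin_num.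
  by move=> ij; rewrite IH// (leq_trans (ltnW ij)).
have Jfin y : y < 0 -> damped_moment P j y \is a fin_num.
  case: j fin {IH jN} => [_|j fin] y0; first by rewrite damped_moment0_fin// ltW.
  by rewrite damped_momentS_fin// fin.
apply: moment_limit => //.
pose q := drop_poly j p.
have qk : bigO 1 (fun x => q.[k x] - q.[0]).
  apply: bigO_horner; [exact: leq_bigO k_O|exact: bigO_cst|].
  by apply: eq_bigO k_O; apply: nearW => x; rewrite subr0.
have q0 : q.[0] = p`_j by rewrite horner_coef0 coef_drop_poly.
suff h : bigO 1 (fun x => fine (damped_moment P j (k x)) - q.[k x]).
  have := bigOD h qk; apply: eq_bigO; apply: nearW => x.
  by rewrite q0 addrA subrK.
apply: (@bigO_div_k _ j).
have jN1 : (j.+1 <= N.+1)%N by [].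
apply: eq_bigO (leq_bigO jN1 hp).
apply: filterS k_lt0 => x kx.
have -> : p.[k x] = (take_poly j p).[k x] + q.[k x] * k x ^+ j.
  by rewrite -[in LHS](poly_take_drop j p) !hornerE.
rewrite (psi_expansion P_nonneg kx fin) (@horner_coef_wide _ j) ?size_take_poly//.
rewrite (_ : \sum_(i < j) (take_poly j p)`_i * k x ^+ i =
    \sum_(i < j) fine (moment P i) * k x ^+ i); first by ring.
apply: eq_bigr => i _; rewrite coef_take_poly ltn_ord IH//.
by rewrite (leq_trans _ jN)// ltnW.
Qed.

End MomentsOfExpansion.

(** * Support, tails and moments *)

Section Tails.
Variables (R : realType) (P : probability (measurableTypeR R) R).

Local Notation D := (`[0, +oo[%classic : set (measurableTypeR R)).

Definition null_above (M : R) := P `]M, +oo[%classic = 0%E.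

Lemma null_above_le_integral (M : R) (f g : measurableTypeR R -> \bar R) :
  null_above M -> measurable_fun D f -> measurable_fun D g ->
  (forall s, D s -> (0 <= f s)%E) -> (forall s, D s -> (0 <= g s)%E) ->
  (forall s, 0 <= s <= M -> (f s <= g s)%E) ->
  (\int[P]_(s in D) f s <= \int[P]_(s in D) g s)%E.
Proof.
move=> PM mf mg f0 g0 fg.
apply: ae_ge0_le_integral => //.
exists `]M, +oo[%classic; split; [exact: measurable_itv|exact: PM|].
move=> s /= /not_implyP[Ds /negP fgs]; rewrite in_itv /= andbT ltNge.
apply/negP => sM; apply/negP: fgs; rewrite negbK; apply: fg.
by rewrite sM (itv0y_ge0 Ds).
Qed.

Lemma null_above_momentS M n : 0 <= M -> null_above M ->
  (moment P n.+1 <= M%:E * moment P n)%E.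
Proof.
move=> M0 PM; rewrite /moment.
have ge0 s : D s -> (0 <= (s ^+ n)%:E)%E.
  by move=> /itv0y_ge0 s0; rewrite lee_fin exprn_ge0.
have ME : (0 <= M%:E)%E by [].
rewrite -(ge0_integralZl P (@measurable_itv0y R) (measurable_moment n) ge0 ME).
apply: (null_above_le_integral PM).
- exact: measurable_moment.
- by apply: emeasurable_funM; [exact: measurable_cst|exact: measurable_moment].
- by move=> s /itv0y_ge0 s0; rewrite lee_fin exprn_ge0.
- by move=> s /itv0y_ge0 s0; rewrite -EFinM lee_fin mulr_ge0// exprn_ge0.
move=> s /andP[s0 sM]; rewrite -EFinM lee_fin exprS ler_wpM2r//.
by rewrite exprn_ge0.
Qed.

Lemma null_above_moment M n : 0 <= M -> null_above M -> on_nonneg P ->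
  (moment P n <= (M ^+ n)%:E)%E.
Proof.
move=> M0 PM P0; elim: n => [|n IH]; first by rewrite expr0 (moment0 P0).
apply: le_trans (null_above_momentS n M0 PM) _.
by rewrite exprS EFinM lee_pmul// ?lee_fin ?moment_ge0.
Qed.

Lemma null_above_moment1 M n : 0 <= M -> null_above M ->
  (moment P n.+1 <= (M ^+ n)%:E * moment P 1)%E.
Proof.
move=> M0 PM; elim: n => [|n IH]; first by rewrite expr0 mul1e.
apply: le_trans (null_above_momentS n.+1 M0 PM) _.
by rewrite exprS EFinM -muleA lee_pmul// ?lee_fin ?moment_ge0.
Qed.

Lemma moment_ge_tail r n : 0 <= r ->
  ((r ^+ n)%:E * P `]r, +oo[%classic <= moment P n)%E.
Proof.
move=> r0; have mr : measurable (`]r, +oo[%classic : set (measurableTypeR R)).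
  exact: measurable_itv.
rewrite -integral_cst// /moment.
have sub : `]r, +oo[%classic `<=` D.
  by move=> s /=; rewrite !in_itv /= !andbT => /ltW; exact: le_trans.
apply: le_trans (ge0_subset_integral P mr (@measurable_itv0y R)
  (measurable_moment n) _ sub); last first.
  by move=> s /itv0y_ge0 s0; rewrite lee_fin exprn_ge0.
apply: ge0_le_integral => //.
- by move=> s _; rewrite lee_fin exprn_ge0.
- exact: measurable_funS (@measurable_itv0y R) sub (measurable_moment n).
move=> s /=; rewrite in_itv /= andbT => rs.
by rewrite lee_fin lerXn2r ?nnegrE ?(ltW rs) ?(le_trans r0 (ltW rs)).
Qed.

(** A mass [e > 0] beyond [r'] would give [r'^n e <= r^n] for all [n >= 1] by Markov's inequality,
    whereas [(r' / r)^n] is unbounded. *)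
Lemma null_above_of_moments r r' : 0 < r -> r < r' ->
  (forall n, (moment P n.+1 <= (r ^+ n.+1)%:E)%E) -> null_above r'.
Proof.
move=> r0 rr' mom; rewrite /null_above.
have mr : measurable (`]r', +oo[%classic : set (measurableTypeR R)).
  exact: measurable_itv.
have [e Pe] : exists e, P `]r', +oo[%classic = e%:E.
  exists (fine (P `]r', +oo[%classic)); rewrite fineK// ge0_fin_numE ?measure_ge0//.
  by rewrite (le_lt_trans (probability_le1 P mr))// ltry.
have e0 : 0 <= e by rewrite -lee_fin -Pe measure_ge0.
rewrite Pe; congr (_%:E); apply/eqP; rewrite eq_le e0 andbT leNgt; apply/negP => ep.
have rho1 : 1 < r' / r by rewrite ltr_pdivlMr// mul1r.
have [n] := geometric_unbounded 1 rho1 ep.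
apply/negP; rewrite -leNgt.
have := le_trans (moment_ge_tail n.+1 (ltW (lt_trans r0 rr'))) (mom n).
rewrite Pe -EFinM lee_fin mulrC -ler_pdivlMr ?exprn_gt0 ?(lt_trans r0)//.
rewrite -expr_div_n -(invf_div r' r) => he.
have r1 : 0 < r' / r by rewrite (lt_trans ltr01).
apply: (@le_trans _ _ ((r' / r) ^+ n.+1 * e)).
  by rewrite ler_wpM2r// exprS ler_peMl ?exprn_ge0 ?(ltW r1) ?(ltW rho1).
apply: le_trans (ler_wpM2l (exprn_ge0 _ (ltW r1)) he) _.
by rewrite -exprMn mulfV ?expr1n// gt_eqF.
Qed.

End Tails.

Section Support.
Variables (R : realType) (P : probability (measurableTypeR R) R).

Lemma measurable_above (M : R) :
  measurable (`]M, +oo[%classic : set (measurableTypeR R)).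
Proof. exact: measurable_itv. Qed.

Lemma null_above_mono (M M' : R) : M <= M' -> null_above P M -> null_above P M'.
Proof.
move=> MM' PM; apply: (subset_measure0 _ _ _ PM).
- exact: measurable_above.
- exact: measurable_above.
- by move=> s /=; rewrite !in_itv /= !andbT; exact: le_lt_trans.
Qed.

Lemma open_null (U : set R) : open U -> ~ (0 < P U)%E -> P U = 0%E.
Proof.
move=> oU /negP; rewrite -leNgt => PU; apply/eqP.
by rewrite eq_le PU measure_ge0.
Qed.

(* The complement of the support is covered by countably many null intervals
   with rational endpoints. *)
Lemma null_above_supp (M : R) : (forall x, supp P x -> x <= M) -> null_above P M.
Proof.
move=> suppM.
pose itv (q : rat * rat) : set (measurableTypeR R) :=
  `]ratr q.1, ratr q.2[%classic.
pose F n : set (measurableTypeR R) :=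
  if unpickle n is Some q then if P (itv q) == 0%E then itv q else set0
  else set0.
apply: measure_negligible; first exact: measurable_above.
have : P.-negligible (\bigcup_k F k).
  apply: negligible_bigcup => k; rewrite /F; case: unpickle => [q|]; last first.
    exact: negligible_set0.
  case: eqP => [Pq|_]; last exact: negligible_set0.
  by exists (itv q); split => //; exact: measurable_itv.
apply: negligibleS => x /=; rewrite in_itv /= andbT => Mx.
have /existsNP[U /not_implyP[oU /not_implyP[Ux PU]]] : ~ supp P x.
  by move/suppM; rewrite leNgt Mx.
have PU0 := open_null oU PU.
have [e /= e0 eU] : nbhs x U by exact: open_nbhs_nbhs.
have [q1] : exists q : rat, ratr q \in `]x - e, x[.
  by apply: rat_in_itvoo; rewrite gtrBl.
rewrite in_itv /= => /andP[eq1 q1x].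
have [q2] : exists q : rat, ratr q \in `]x, x + e[.
  by apply: rat_in_itvoo; rewrite ltrDl.
rewrite in_itv /= => /andP[xq2 q2e].
have itvU : itv (q1, q2) `<=` U.
  move=> y; rewrite /itv /= in_itv /= => /andP[q1y yq2]; apply: eU => /=.
  by rewrite ltr_norml; apply/andP; split; lra.
have Pq : P (itv (q1, q2)) = 0%E.
  apply: (subset_measure0 _ _ itvU PU0); first exact: measurable_itv.
  exact: open_measurable.
have xq : itv (q1, q2) x by rewrite /itv /= in_itv /= q1x xq2.
move: (q1, q2) Pq xq => q Pq xq.
exists (pickle q); first exact: I.
by rewrite /F pickleK Pq eqxx.
Qed.

Hypothesis P_nonneg : on_nonneg P.

Lemma null_above_ge0 (M : R) : null_above P M -> 0 <= M.
Proof.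
move=> PM; rewrite leNgt; apply/negP => M0.
have : (P `[0%R, +oo[%classic <= P `]M, +oo[%classic)%E.
  apply: le_measure; rewrite ?inE; [exact: measurable_itv0y|exact: measurable_above|].
  by move=> s /=; rewrite !in_itv /= !andbT; exact: lt_le_trans.
by rewrite P_nonneg PM lee_fin ler10.
Qed.

(** The infimum [M] of the null thresholds is itself one, by countable additivity. It lies in the
    support, since a null neighbourhood of [M] would allow a smaller threshold. Hence the support
    has a maximum and [xget] does not return its default. *)
Lemma supp_max_spec (r : R) : null_above P r ->
  [/\ 0 <= supp_max P, supp_max P <= r & null_above P (supp_max P)].
Proof.
move=> Pr.
pose A : set R := [set M | null_above P M].
have Ar : A r by [].
have A0 : lbound A 0 by move=> M; exact: null_above_ge0.
have Ainf : has_inf A by split; [exists r|exists 0].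
pose M := inf A.
have PM : null_above P M.
  apply: measure_negligible; first exact: measurable_above.
  have : P.-negligible (\bigcup_k (`]M + k.+1%:R^-1, +oo[%classic : set (measurableTypeR R))).
    apply: negligible_bigcup => k; exists (`]M + k.+1%:R^-1, +oo[%classic).
    split; [exact: measurable_above| |by []].
    have [a Aa aM] := @inf_adherent _ A k.+1%:R^-1 (ltac:(by rewrite invr_gt0)) Ainf.
    exact: null_above_mono (ltW aM) Aa.
  apply: negligibleS => x /=; rewrite in_itv /= andbT => Mx.
  have [k kx] : exists k : nat, (x - M)^-1 < k.+1%:R.
    by exists (Num.truncn (x - M)^-1); rewrite truncnS_gt.
  exists k => //=; rewrite in_itv /= andbT -ltrBrDl.
  by rewrite invf_plt ?posrE ?subr_gt0.
have suppM : supp P M.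
  move=> U oU UM; rewrite lt0e measure_ge0 andbT; apply/eqP => PU.
  have [e /= e0 eU] : nbhs M U by exact: open_nbhs_nbhs.
  have : A (M - e / 2).
    have mU : measurable (U : set (measurableTypeR R)) by exact: open_measurable.
    have mA := measurable_above.
    have sub : (`]M - e / 2, +oo[%classic : set (measurableTypeR R))
        `<=` U `|` `]M, +oo[%classic.
      move=> s /=; rewrite in_itv /= andbT => Ms.
      have [sM|sM] := ltP M s; [right|left]; first by rewrite /= in_itv /= sM.
      apply: eU => /=; rewrite ger0_norm ?subr_ge0//; lra.
    apply: (subset_measure0 (mA _) (measurableU _ _ mU (mA M)) sub).
    by have := null_set_setU mU (mA M) PU PM.
  move=> /(ge_inf (proj2 Ainf)); rewrite -/M; lra.
have ubM : ubound (supp P) M.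
  move=> x sx; rewrite leNgt; apply/negP => Mx.
  have := sx `]M, +oo[%classic; rewrite PM ltxx.
  by move=> h; have : false by apply: h; [exact: interval_open|rewrite /= in_itv /= Mx].
suff -> : supp_max P = M.
  by split=> //; [exact: lb_le_inf (proj1 Ainf) A0|exact: ge_inf (proj2 Ainf) _ Ar].
have [sm um] : (supp P `&` ubound (supp P)) (supp_max P).
  by apply: xgetPex; exists M.
by apply/eqP; rewrite eq_le ubM// um.
Qed.

End Support.

(** * Subordination *)

Lemma pinv_notin (T U : Type) (dflt : U -> T) (A : set T) (f : T -> U) (y : U) :
  ~ (f @` A) y -> 'pinv_dflt A f y = dflt y.
Proof. by move=> fy; rewrite /pinv_ splitV /= oinv_surj; case: pselect. Qed.

Section Eta.
Variables (R : realType) (P : probability (measurableTypeR R) R) (L : R).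
Hypotheses (P_nonneg : on_nonneg P) (L0 : 0 <= L) (PL : null_above P L).
Hypothesis P_mean : moment P 1 = 1%E.

Local Notation D := (`[0, +oo[%classic : set (measurableTypeR R)).

(** On [[0, L]] the integrand of [damped_moment 0] grows by [(y2 - y1) s / ((1 - y1 s) (1 - y2 s))
    >= c s], where [c] takes the denominators at [s = L]. Integration against mean [1] gives a gain
    of at least [c > 0]. *)
Lemma ltr_psi y1 y2 : y1 < y2 -> y2 < 0 -> psi P y1 < psi P y2.
Proof.
move=> y12 y20; have y10 := lt_trans y12 y20.
rewrite -(ltrD2l 1) !psiE//.
pose c := (y2 - y1) / ((1 - y1 * L) * (1 - y2 * L)).
have yL (y s : R) : y < 0 -> 0 <= s -> 0 < 1 - y * s.
  by move=> y0 s0; rewrite subr_gt0 (le_lt_trans _ ltr01)// mulr_le0_ge0// ltW.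
have c0 : 0 < c by rewrite divr_gt0 ?subr_gt0// mulr_gt0 ?yL.
suff : (damped_moment P 0 y1 + c%:E * moment P 1 <= damped_moment P 0 y2)%E.
  have := damped_moment0_fin P_nonneg (ltW y10).
  have := damped_moment0_fin P_nonneg (ltW y20).
  rewrite P_mean mule1; case: (damped_moment P 0 y1) => // a.
  case: (damped_moment P 0 y2) => // b _ _.
  by rewrite lee_fin /=; apply: lt_le_trans; rewrite ltrDl.
have ge1 s : D s -> (0 <= (s ^+ 1)%:E)%E by move=> /itv0y_ge0 s0; rewrite lee_fin.
have ge0 y s : y < 0 -> D s -> (0 <= (s ^+ 0 / (1 - y * s))%:E)%E.
  by move=> y0 Ds; rewrite lee_fin damped_ge0 ?ltW.
have ce : (0 <= c%:E)%E by rewrite lee_fin ltW.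
have mc : measurable_fun D (fun s : R => (c%:E * (s ^+ 1)%:E)%E).
  by apply: emeasurable_funM; [exact: measurable_cst|exact: measurable_moment].
have gec s : D s -> (0 <= c%:E * (s ^+ 1)%:E)%E by move=> Ds; rewrite mule_ge0// ge1.
have m1 := measurable_damped 0 (ltW y10).
rewrite /damped_moment /moment.
rewrite -(ge0_integralZl P (@measurable_itv0y R) (measurable_moment 1) ge1 ce).
rewrite -(ge0_integralD P (@measurable_itv0y R) (fun s => ge0 y1 s y10) m1 gec mc).
apply: (null_above_le_integral PL).
- exact: emeasurable_funD.
- exact: (measurable_damped 0 (ltW y20)).
- by move=> s Ds; rewrite adde_ge0 ?ge0 ?gec.
- by move=> s Ds; rewrite ge0.
move=> s /andP[s0 sL]; rewrite -EFinM -EFinD lee_fin !expr0 expr1 !mul1r.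
have h1 := yL _ _ y10 s0; have h2 := yL _ _ y20 s0.
have e : (1 - y2 * s)^-1 - (1 - y1 * s)^-1
    = (y2 - y1) * s / ((1 - y1 * s) * (1 - y2 * s)).
  by field; rewrite !gt_eqF.
rewrite -lerBrDl e /c mulrAC ler_wpM2l ?mulr_ge0 ?subr_ge0 ?(ltW y12)//.
rewrite lef_pV2 ?posrE ?mulr_gt0 ?yL// ler_pM ?(ltW h1) ?(ltW h2)//.
  by rewrite lerD2l lerN2 ler_wnM2l// ltW.
by rewrite lerD2l lerN2 ler_wnM2l// ltW.
Qed.

(** [psiE] only gives [0 <=]; strictness comes from comparison with the point [y - 1]. *)
Lemma psi_gtN1 y : y < 0 -> 0 < 1 + psi P y.
Proof.
move=> y0; have y1 : y - 1 < y by rewrite gtrBl.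
rewrite (le_lt_trans _ (_ : 1 + psi P (y - 1) < _)) ?ltrD2l ?ltr_psi//.
rewrite psiE ?(lt_trans y1)// fine_ge0// damped_moment_ge0//.
by rewrite ltW// (lt_trans y1).
Qed.

Lemma eta_inj : {in `]-oo, 0[%classic &, injective (eta P)}.
Proof.
move=> y1 y2; rewrite !inE /= !in_itv /= => y10 y20.
have h1 := psi_gtN1 y10; have h2 := psi_gtN1 y20.
rewrite /eta => /eqP; rewrite eqr_div ?(lt0r_neq0 h1) ?(lt0r_neq0 h2)// => /eqP e.
have {}e : psi P y1 = psi P y2 by lra.
have [y12|y21|//] := ltgtP y1 y2.
  by have := ltr_psi y12 y20; rewrite e ltxx.
by have := ltr_psi y21 y10; rewrite e ltxx.
Qed.

Lemma eta_invK y : y < 0 -> eta_inv P (eta P y) = y.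
Proof. by move=> y0; apply: (pinvKV (fun=> 0) eta_inj); rewrite inE /= in_itv. Qed.

End Eta.

Section Subordination.
Variables (R : realType) (mu nu : probability (measurableTypeR R) R) (L t : R).
Hypotheses (mu_nonneg : on_nonneg mu) (L0 : 0 <= L) (muL : null_above mu L).
Hypothesis mu_mean : moment mu 1 = 1%E.
Hypothesis nu_power : free_mul_power mu t nu.
Hypothesis psi_lt0 : \forall x \near 0^'-, psi mu x < 0.
Hypothesis psi_O : bigO 1 (psi mu).

Lemma eta_psi (P : probability (measurableTypeR R) R) y w : w < 0 ->
  eta P y = w -> psi P y = w / (1 - w).
Proof.
rewrite /eta => w0 e; have h : 1 + psi P y != 0.
  (* If [1 + psi P y] vanished, the convention for division by [0] would give [w = 0]. *)
  by apply: contraTneq w0 => h; rewrite -e h invr0 mulr0 ltxx.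
have w1 : 1 - w != 0 by rewrite gt_eqF// subr_gt0 (lt_trans w0).
move/(canRL (mulfVK h)): e; rewrite mulrDr mulr1 => e.
by apply: (mulIf w1); rewrite divfK// mulrBr mulr1; lra.
Qed.

(** The defining relation of the power is evaluated at [w = eta mu x], where [eta_inv mu w = x]. It
    gives [eta_inv nu w = kx], hence [eta nu kx = eta mu x], and [psi] is a function of [eta]. *)
Lemma psi_subordination :
  \forall x \near 0^'-,
    psi nu (x * expR ((1 - t) * ln (psi mu x / (1 + psi mu x) / x))) = psi mu x.
Proof.
have [_ _ [d /= d0 hd]] := nu_power.
(* The bound [1/2] ensures [1 + psi mu x > 1/2], so [|w| < 2 |psi mu x|], and [d / 2] then gives
   [|w| < d]. *)
have d20 : 0 < Num.min (d / 2) 2^-1 :> R by rewrite lt_min; apply/andP; split; lra.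
near=> x.
have x0 : x < 0 by near: x; exact: nbhs_left_lt.
have psi0 : psi mu x < 0 by near: x.
have psid : `|psi mu x| < Num.min (d / 2) 2^-1.
  by near: x; exact: bigO_small.
have psi1 := psi_gtN1 mu_nonneg L0 muL mu_mean x0.
rewrite -/(eta mu x); set w := eta mu x.
have w0 : w < 0 by rewrite /w /eta pmulr_llt0 ?invr_gt0.
have wd : `|w| < d.
  move: psid; rewrite lt_min !ltr0_norm// => /andP[pd p2].
  by rewrite /w /eta -mulNr ltr_pdivrMr//; nra.
have {hd} := hd w; rewrite /= sub0r normrN => /(_ wd w0).
have muw : Sigma mu w = x / w.
  by rewrite /Sigma (eta_invK mu_nonneg L0 muL mu_mean x0).
have wx0 : 0 < w / x by rewrite -mulrNN -invrN divr_gt0 ?oppr_gt0.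
have xw0 : 0 < x / w by rewrite -invf_div invr_gt0.
rewrite muw /Sigma => /(canRL (mulfVK (ltr0_neq0 w0))).
have -> : (x / w) `^ t * w = x * expR ((1 - t) * ln (w / x)).
  rewrite /powR (gt_eqF xw0) -(invf_div w x) lnV ?posrE// mulrN -mulNr.
  have -> : expR (- t * ln (w / x)) * w = x * (expR (- t * ln (w / x)) * (w / x)).
    by field; rewrite lt_eqF.
  by rewrite -{2}(lnK wx0) -expRD; congr (x * expR _); ring.
set kx := x * _ => kE.
have kx0 : kx < 0 by rewrite /kx pmulr_llt0// expR_gt0.
have etak : eta nu kx = w.
  rewrite -kE; apply: pinvK; rewrite inE.
  (* Outside the range of [eta nu], [eta_inv nu w] would be the default [0], contradicting
     [kx < 0]. *)
  have [//|h] := pselect ((eta nu @` `]-oo, 0[%classic) w).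
  by move: kE kx0; rewrite /eta_inv pinv_notin// => <-; rewrite ltxx.
by rewrite (eta_psi w0 etak) (eta_psi w0 (erefl w : eta mu x = w)).
Unshelve. all: by end_near. Qed.

End Subordination.

(** * Mean and variance *)

Section MeanVariance.
Variables (R : realType) (mu : probability (measurableTypeR R) R).
Hypothesis mu_nonneg : on_nonneg mu.

Local Notation D := (`[0, +oo[%classic : set (measurableTypeR R)).

Lemma negligible_setCD : mu.-negligible (~` D).
Proof.
have mDC : measurable (~` D) by apply: measurableC; exact: measurable_itv0y.
exists (~` D); split; [exact: mDC| |by []].
by rewrite (probability_setC mu (@measurable_itv0y R)) mu_nonneg subee.
Qed.

Lemma integral_nonneg_support (f : R -> R) : measurable_fun setT f ->
  (\int[mu]_s (f s)%:E = \int[mu]_(s in D) (f s)%:E)%E.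
Proof.
move=> mf; rewrite [RHS]integral_mkcond; apply: ae_eq_integral => //.
- exact/measurable_EFinP.
- apply/(measurable_restrictT _ (@measurable_itv0y R)).
  by apply/measurable_EFinP; exact: measurable_funTS.
apply: negligibleS negligible_setCD => s /= h Ds; apply: h => _.
by rewrite /patch mem_set.
Qed.

Lemma moment1_expectation : moment mu 1 = ('E_mu[(fun s : R => s)])%E.
Proof.
rewrite unlock integral_nonneg_support; last exact: measurable_id.
by apply: eq_integral => s _; rewrite expr1.
Qed.

Hypothesis mu_mean : ('E_mu[(fun s : R => s)] = 1)%E.

Lemma variance_integral :
  ('V_mu[(fun s : R => s)] = \int[mu]_(s in D) ((s - 1) ^+ 2)%:E)%E.
Proof.
rewrite /variance unlock mu_mean unlock /=.
have m : measurable_fun setT (fun s : R => (s - 1) ^+ 2).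
  apply: measurable_funX; exact: measurable_funB.
rewrite -(integral_nonneg_support m).
by apply: eq_integral => s _; rewrite expr2.
Qed.

(** Arranged so that all integrands are nonnegative: [s^2 + 1 = (s - 1)^2 + 2 s] is integrated with
    mean [1]. *)
Lemma variance_moment2 :
  (moment mu 2 + 1 = 'V_mu[(fun s : R => s)] + 2%:E)%E.
Proof.
have mm := @measurable_moment R.
have ge0 n s : D s -> (0 <= (s ^+ n)%:E)%E.
  by move=> /itv0y_ge0 s0; rewrite lee_fin exprn_ge0.
have two : (0 <= 2%:E :> \bar R)%E by rewrite lee_fin.
have m1 : measurable_fun D (fun s : R => (2%:E * (s ^+ 1)%:E)%E).
  by apply: emeasurable_funM; [exact: measurable_cst|exact: mm].
have g1 s : D s -> (0 <= 2%:E * (s ^+ 1)%:E)%E by move=> Ds; rewrite mule_ge0// ge0.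
have m2 : measurable_fun D (fun s : R => ((s - 1) ^+ 2)%:E).
  apply/measurable_EFinP; apply: measurable_funTS.
  by apply: measurable_funX; exact: measurable_funB.
have g2 s : D s -> (0 <= ((s - 1) ^+ 2)%:E)%E by move=> _; rewrite lee_fin sqr_ge0.
rewrite -(moment0 mu_nonneg) variance_integral.
have -> : 2%:E = (2%:E * moment mu 1)%E.
  by rewrite moment1_expectation mu_mean mule1.
rewrite /moment.
rewrite -(ge0_integralD mu (@measurable_itv0y R) (ge0 2) (mm 2) (ge0 0) (mm 0)).
rewrite -(ge0_integralZl mu (@measurable_itv0y R) (mm 1) (ge0 1) two).
rewrite -(ge0_integralD mu (@measurable_itv0y R) g2 m2 g1 m1).
apply: eq_integral => s _; rewrite -EFinM -!EFinD; congr (_%:E); ring.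
Qed.

Lemma variance_eq0_dirac : ('V_mu[(fun s : R => s)] = 0)%E -> is_dirac mu.
Proof.
rewrite variance_integral => V0; exists 1 => A mA.
have m2 : measurable_fun D (fun s : R => ((s - 1) ^+ 2)%:E).
  apply/measurable_EFinP; apply: measurable_funTS.
  by apply: measurable_funX; exact: measurable_funB.
have : ae_eq mu D (fun s : R => ((s - 1) ^+ 2)%:E) (cst 0%E).
  apply/(ae_eq_integral_abs mu (@measurable_itv0y R) m2); rewrite -[RHS]V0.
  by apply: eq_integral => s _; rewrite gee0_abs// lee_fin sqr_ge0.
move=> ae1.
have [N [mN N0 subN]] : mu.-negligible [set s : R | s != 1].
  apply: negligibleS (negligibleU ae1 negligible_setCD) => s /= s1.
  have [Ds|Ds] := pselect (D s); [left|by right].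
  move=> /(_ Ds) [e]; move/eqP: e; rewrite sqrf_eq0 subr_eq0.
  by apply/negP.
have null1 (B : set (measurableTypeR R)) : measurable B -> ~ B 1 -> mu B = 0%E.
  move=> mB B1; apply: (subset_measure0 mB mN _ N0) => s Bs; apply: subN => /=.
  by apply: contra_not_neq B1 => <-.
rewrite diracE; case: (pselect (A 1)) => A1.
  rewrite mem_set//.
  have := probability_setC mu mA; rewrite null1//; last exact: measurableC.
  have := probability_le1 mu mA; have := measure_ge0 mu A.
  case: (mu A) => //= a _ _ [a1].
  by congr (_%:E); lra.
by rewrite memNset// null1.
Qed.

End MeanVariance.

(** * Moments and support of the convolution powers *)

Lemma coef_comp_polyZX (R : comNzRingType) (p : {poly R}) (c : R) j :
  (p \Po (c *: 'X))`_j = c ^+ j * p`_j.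
Proof.
elim/poly_ind: p j => [|p d IH] j; first by rewrite comp_poly0 coef0 mulr0.
rewrite comp_polyD comp_polyM comp_polyX comp_polyC -scalerAr !coefD !coefC.
rewrite coefZ !coefMX; case: j => [|j] /=.
  by rewrite mulr0 !add0r expr0 mul1r.
by rewrite !addr0 IH exprS mulrA.
Qed.

Section Powers.
Variables (R : realType) (mu : probability (measurableTypeR R) R) (L : R).
Hypotheses (mu_nonneg : on_nonneg mu) (L1 : 1 <= L) (muL : null_above mu L).
Hypothesis mu_mean : moment mu 1 = 1%E.

Let m n := fine (moment mu n).
Let L0 : 0 <= L. Proof. exact: le_trans ler01 L1. Qed.

Let moment_le n : (moment mu n <= (L ^+ n)%:E)%E.
Proof. exact: null_above_moment. Qed.

Lemma moment_fin n : moment mu n \is a fin_num.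
Proof.
by rewrite ge0_fin_numE ?moment_ge0// (le_lt_trans (moment_le n))// ltry.
Qed.

Let mE n : moment mu n = (m n)%:E.
Proof. by rewrite /m fineK// moment_fin. Qed.

Let m0 : m 0%N = 1. Proof. by rewrite /m moment0. Qed.
Let m1 : m 1%N = 1. Proof. by rewrite /m mu_mean. Qed.

Let norm_m n : `|m n| <= L ^+ n.
Proof.
rewrite ger0_norm; first by rewrite -lee_fin -mE moment_le.
by rewrite -lee_fin -mE moment_ge0.
Qed.

Let m_le n : `|m n| <= (L ^+ 2) ^+ n.
Proof.
by rewrite (le_trans (norm_m n))// lerXn2r ?nnegrE ?exprn_ge0// ler_eXnr.
Qed.

(** The rate [L ^+ 2] also dominates the shifted sequence: [n + 1 <= 2 n] for [n >= 1], and the mean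
    is [1] for [n = 0]. *)
Let m_leS n : `|m n.+1| <= (L ^+ 2) ^+ n.
Proof.
case: n => [|n]; first by rewrite m1 normr1.
rewrite (le_trans (norm_m _))// -exprM ler_weXn2l// mul2n -addnn addSn ltnS.
by rewrite leq_addl.
Qed.

Lemma psi_bigO N : bigO N.+1 (fun x => psi mu x - (series_poly m N).[x]).
Proof.
exists (L ^+ N.+1).
have x0 : \forall x \near (0 : R)^'-, x < 0 by exact: nbhs_left_lt.
apply: filterS x0 => x x0.
have fin i : (i < N.+1)%N -> moment mu i \is a fin_num by rewrite moment_fin.
have := psi_expansion mu_nonneg x0 fin.
rewrite /series_poly hornerD hornerN hornerC horner_poly.
move=> /(canRL (addKr 1)) e.
rewrite (_ : _ - _ = x ^+ N.+1 * fine (damped_moment mu N.+1 x)); last first.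
  by rewrite e /m; ring.
rewrite normrM normrX mulrC ler_wpM2r ?exprn_ge0//.
have := damped_moment_ge0 mu N.+1 (ltW x0).
have := le_trans (damped_le_moment mu N.+1 (ltW x0)) (moment_le N.+1).
case: (damped_moment mu N.+1 x) => //= a.
by rewrite !lee_fin => aL a0; rewrite ger0_norm.
Qed.

Lemma psi_near_lt0 : \forall x \near 0^'-, psi mu x < 0.
Proof.
have s1 : series_poly m 1 = 'X.
  apply/polyP => -[|[|i]]; rewrite coef_series_poly// coefX//=.
near=> x.
have x0 : x < 0 by near: x; exact: nbhs_left_lt.
have : `|(psi mu x - (series_poly m 1).[x]) / x| < 1.
  by near: x; apply: bigO_small => //; exact/bigO_divx/psi_bigO.
rewrite s1 hornerX mulrBl divff ?lt_eqF// ltr_norml => /andP[+ _].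
rewrite ltrBrDr addNr => h.
by rewrite -(ltr_nM2r (_ : x^-1 < 0)) ?invr_lt0// mul0r.
Unshelve. all: by end_near. Qed.

Definition power_poly (t : R) N : {poly R} :=
  series_poly m N \Po (t^-1 *: inv_poly N (log_ratio_poly m N) t N).

Variables (t : R) (nu : probability (measurableTypeR R) R).
Hypotheses (t1 : 1 < t) (nu_power : free_mul_power mu t nu).

(** [f_expansion] expands [psi mu x] in powers of [k x], [psi_subordination] identifies it with
    [psi nu (k x)], and [moment_of_expansion] reads off the coefficients. The factor [t ^+ j] undoes
    the scaling by [t]. *)
Lemma moment_power N j : (0 < j <= N)%N ->
  moment nu j = (t ^+ j * (power_poly t N)`_j)%:E.
Proof.
case/andP => j0 jN.
have [nu_nonneg _ _] := nu_power.
pose k x := x * expR ((1 - t) * ln (psi mu x / (1 + psi mu x) / x)).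
have k_lt0 : \forall x \near 0^'-, k x < 0.
  have x0 : \forall x \near (0 : R)^'-, x < 0 by exact: nbhs_left_lt.
  by apply: filterS x0 => x x0; rewrite /k pmulr_llt0 ?expR_gt0.
have kO := bigO_k m0 m1 psi_bigO t.
have kL := k_lower m0 m1 psi_bigO t.
have h := psi_subordination mu_nonneg L0 muL mu_mean nu_power psi_near_lt0
  (bigO_f m0 psi_bigO).
have e := f_expansion m0 m1 psi_bigO t1 N.
have := @moment_of_expansion _ nu nu_nonneg k k_lt0 kO kL N
  (1 + (power_poly t N \Po (t *: 'X))) _ j jN.
rewrite coefD coef1 gtn_eqF// add0r coef_comp_polyZX; apply.
apply: eq_bigO e; apply: filterS h => x; rewrite -/(k x) => ->.
have -> : (1 + (power_poly t N \Po (t *: 'X))).[k x]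
    = 1 + (power_poly t N).[t * k x].
  by rewrite hornerD hornerC horner_comp [(t *: 'X).[_]]hornerZ hornerX.
by rewrite /power_poly /k; ring.
Qed.

Let V := m 2%N - 1.
(** The largest radius allowed by [pnorm_series_poly] for the rate [L ^+ 2]. *)
Let x0 := (3 * L ^+ 2)^-1.

Let x0_gt0 : 0 < x0.
Proof. by rewrite invr_gt0 mulr_gt0// exprn_gt0// (lt_le_trans ltr01). Qed.

Lemma supp_max_power_le : 0 < V -> V^-1 / t <= x0 ->
  [/\ 0 <= supp_max nu, null_above nu (supp_max nu) &
      supp_max nu / t <= V * expR (1 + 2 * V^-1 ^+ 2 / x0 ^+ 2 / t)].
Proof.
move=> V0 Vt; have [nu_nonneg _ _] := nu_power.
have t0 : 0 < t := lt_trans ltr01 t1.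
set E := expR _; have E0 : 0 < E := expR_gt0 _.
have u0 : 0 < V^-1 by rewrite invr_gt0.
(* With [u = 1 / V] one has [V u = 1], whence the factor [e]. The constant [2] in [E] is the bound
   of [pnorm_log_ratio_poly], and [r * E = u] is the equality case of the last hypothesis of
   [pnorm_inv_poly]. *)
pose r := V^-1 / E; have r0 : 0 < r by rewrite divr_gt0.
have Kx : 3 * (L ^+ 2 * x0) <= 1.
  by rewrite mulrA mulfV// gt_eqF// -invr_gt0.
have mom n : (moment nu n.+1 <= ((t / r) ^+ n.+1)%:E)%E.
  rewrite (@moment_power n.+1 n.+1) ?leqnn// lee_fin expr_div_n ler_wpM2l//.
    by rewrite exprn_ge0// ltW.
  rewrite -[leRHS]mul1r ler_pdivlMr ?exprn_gt0//.
  apply: le_trans (_ : `|(power_poly t n.+1)`_n.+1| * r ^+ n.+1 <= _).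
    by rewrite ler_wpM2r ?ler_norm// exprn_ge0// ltW.
  apply: le_trans (coef_le_pnorm (ltW r0) _ _) _.
  apply: le_trans (pnorm_comp _ _ (ltW r0)) _.
  set U := inv_poly _ _ _ _.
  have UV : pnorm r U <= V^-1.
    apply: (@pnorm_inv_poly _ _ _ V 2 x0 t) => //; try exact: ltW.
    - exact: coef_log_ratio_poly_0.
    - by rewrite coef_log_ratio_poly_1// m1 ger0_norm// ltW.
    - exact: (pnorm_log_ratio_poly _ m0 m1 m_le m_leS (ltW x0_gt0) Kx).
    - by rewrite mulfV ?gt_eqF// -/E /r divfK// gt_eqF.
  have UV0 : 0 <= pnorm r (t^-1 *: U) by rewrite pnorm_ge0// ltW.
  have UVx : pnorm r (t^-1 *: U) <= x0.
    apply: le_trans Vt; rewrite pnormZ gtr0_norm ?invr_gt0// mulrC.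
    by rewrite ler_wpM2r// invr_ge0 ltW.
  have UK : 3 * (L ^+ 2 * pnorm r (t^-1 *: U)) <= 1.
    apply: le_trans Kx; rewrite ler_wpM2l// ler_wpM2l// exprn_ge0//.
  apply: le_trans (pnorm_series_poly _ m0 m_le UV0 UK) _; lra.
have tr0 : 0 < t / r by rewrite divr_gt0.
have null r' : t / r < r' -> null_above nu r'.
  by move=> h; exact: null_above_of_moments tr0 h mom.
(* The threshold [t / r + 1] only makes [supp_max nu] a genuine maximum; the sharp bound comes below
   from the midpoint of [t / r] and [supp_max nu]. *)
have [S0 _ PS] := supp_max_spec nu_nonneg (null (t / r + 1) (ltac:(by rewrite ltrDl))).
split => //; rewrite ler_pdivrMr//.
have -> : V * E * t = t / r by rewrite /r invf_div invrK; ring.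
rewrite leNgt; apply/negP => h.
have h' : t / r < (t / r + supp_max nu) / 2 by lra.
have [_ + _] := supp_max_spec nu_nonneg (null _ h'); lra.
Qed.

(** If the maximum were at most [B t], [null_above_moment1] would bound the moment of order [j + 1]
    by [(B t)^j] times the mean. The factors [t - 1] are kept because [(t - 1) *: power_poly t N] is
    what converges. *)
Lemma supp_max_power_gt (B : R) N j : 0 <= B -> (j < N)%N ->
  0 <= supp_max nu -> null_above nu (supp_max nu) ->
  B ^+ j * ((t - 1) * (power_poly t N)`_1) < (t - 1) * (power_poly t N)`_j.+1 ->
  B < supp_max nu / t.
Proof.
move=> B0 jN S0 PS; have t0 : 0 < t := lt_trans ltr01 t1.
rewrite mulrCA ltr_pM2l ?subr_gt0// => Bj.
rewrite ltr_pdivlMr// ltNge; apply/negP => SB.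
have := null_above_moment1 j S0 PS.
have [_ N0] : (0 < 1)%N /\ (0 < N)%N by rewrite (leq_trans _ jN).
rewrite (@moment_power N j.+1)// (@moment_power N 1)// -EFinM lee_fin expr1.
apply/negP; rewrite -ltNge.
have P1 : 0 <= t * (power_poly t N)`_1.
  by have := moment_ge0 nu 1; rewrite (@moment_power N 1)// lee_fin expr1.
apply: (@le_lt_trans _ _ ((B * t) ^+ j * (t * (power_poly t N)`_1))).
  by rewrite ler_wpM2r// lerXn2r ?nnegrE// mulr_ge0// ltW.
rewrite exprMn exprSr.
rewrite [ltLHS](_ : _ = (t ^+ j * t) * (B ^+ j * (power_poly t N)`_1)); last by ring.
by rewrite ltr_pM2l// mulr_gt0// exprn_gt0.
Qed.

End Powers.

Lemma compact_supp_null_above (R : realType) (mu : probability (measurableTypeR R) R) :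
  compact (supp mu) -> exists2 L : R, 1 <= L & null_above mu L.
Proof.
move=> /compact_bounded[M [_ hM]]; exists (Num.max 1 (M + 1)).
  by rewrite le_max lexx.
apply: null_above_supp => x sx; apply: le_trans (ler_norm x) _.
by apply: hM sx; rewrite lt_max ltrDl ltr01 orbT.
Qed.

Theorem theorem1p2 (R : realType) (mu : probability (measurableTypeR R) R)
    (nu : R -> probability (measurableTypeR R) R)
    (mu_nonneg : on_nonneg mu)
    (mu_compact : compact (supp mu))
    (mu_not_dirac : ~ is_dirac mu)
    (mu_mean1 : ('E_mu[(fun s : R => s)] = 1)%E)
    (nu_power : forall t : R, 1 < t -> free_mul_power mu t (nu t)) :
  supp_max (nu t) / t @[t --> +oo] -->
    expR 1 * fine 'V_mu[(fun s : R => s)]%E.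
Proof.
have [L L1 muL] := compact_supp_null_above mu_compact.
have mean : moment mu 1 = 1%E by rewrite moment1_expectation.
pose m n := fine (moment mu n).
pose V := m 2%N - 1.
have VE : 'V_mu[(fun s : R => s)]%E = V%:E.
  have := variance_moment2 mu_nonneg mu_mean1.
  have : moment mu 2 \is a fin_num by exact: (moment_fin mu_nonneg L1 muL).
  rewrite /V /m; case: (moment mu 2) => // a _.
  case: ('V_mu[(fun s : R => s)]%E) => // b.
  by rewrite -!EFinD => -[e]; congr (_%:E); rewrite /=; lra.
rewrite VE /=.
have V0 : 0 < V.
  rewrite lt_neqAle -lee_fin -VE variance_integral//; apply/andP; split.
    apply/eqP => V0; apply: mu_not_dirac.
    by apply: variance_eq0_dirac => //; rewrite VE -V0.
  by apply: integral_ge0 => s _; rewrite lee_fin sqr_ge0.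
pose x0 : R := (3 * L ^+ 2)^-1.
have x00 : 0 < x0 by rewrite invr_gt0 mulr_gt0// exprn_gt0// (lt_le_trans ltr01).
pose c : R := 2 * V^-1 ^+ 2 / x0 ^+ 2.
have spec t : 1 < t -> V^-1 / x0 < t ->
    [/\ 0 <= supp_max (nu t), null_above (nu t) (supp_max (nu t)) &
        supp_max (nu t) / t <= V * expR (1 + c / t)].
  move=> t1 tx; apply: (supp_max_power_le mu_nonneg L1 muL mean t1) => //.
    exact: nu_power.
  by rewrite ler_pdivrMr ?(lt_trans ltr01)// mulrC -ler_pdivrMr// ltW.
have upper : V * expR (1 + c / t) @[t --> +oo] --> expR 1 * V.
  have h : 1 + c / t @[t --> +oo] --> (1 + c * 0 : R).
    apply: cvgD; first exact: cvg_cst.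
    by apply: cvgM; [exact: cvg_cst|exact: cvg_inv_pinfty].
  rewrite mulr0 addr0 in h; rewrite mulrC; apply: cvgM; first exact: cvg_cst.
  exact: (cvg_comp _ _ h (@continuous_expR R 1)).
apply/cvgrPdist_lt => e e0.
(* [B] is within [e] of the limit, and the second argument keeps it positive, as [tree_poly_coef_gt]
   requires. *)
pose B := Num.max (expR 1 * V - e) (expR 1 * V / 2).
have eV : 0 < expR 1 * V by rewrite mulr_gt0// expR_gt0.
have B0 : 0 < B by rewrite lt_max; apply/orP; right; rewrite divr_gt0.
have BV : B < expR 1 * V by rewrite gt_max; apply/andP; split; lra.
have [N [j [jN Bj]]] := tree_poly_coef_gt V0 B0 BV.
have m0 : m 0%N = 1 by rewrite /m moment0.
have m1 : m 1%N = 1 by rewrite /m mean.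
have N0 : (0 < N)%N by rewrite (leq_trans _ jN).
pose l := log_ratio_poly m N.
have l0 : l`_0 = 0 by exact: coef_log_ratio_poly_0.
have l1 : l`_1 = V by rewrite /l coef_log_ratio_poly_1// m1.
have s0 : (series_poly m N)`_0 = 0 by rewrite coef_series_poly.
have s1 : (series_poly m N)`_1 = 1 by rewrite coef_series_poly// N0 m1.
(* [power_poly] composes [series_poly], whose linear coefficient is the mean [1], with
   [t^-1 *: inv_poly]; multiplied by [t - 1] it therefore tends to the tree polynomial
   coefficientwise. *)
have := coef_cvg_rescale s0 (@cvg_inv_poly R N l N l0).
rewrite s1 l1 scale1r -/(power_poly mu _ N) => P_cvg.
have T1 : (tree_poly N V N)`_1 = 1.
  by case: (N) N0 => // k _; exact: coef1_tree_poly.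
have lower : \forall t \near +oo, B ^+ j * ((t - 1) * (power_poly mu t N)`_1)
    < (t - 1) * (power_poly mu t N)`_j.+1.
  have coef_lim i : (t - 1) * (power_poly mu t N)`_i @[t --> +oo] -->
      ((tree_poly N V N)`_i : R).
    under eq_fun do rewrite -coefZ.
    exact: P_cvg.
  have h : (t - 1) * (power_poly mu t N)`_j.+1
      - B ^+ j * ((t - 1) * (power_poly mu t N)`_1) @[t --> +oo] -->
      ((tree_poly N V N)`_j.+1 - B ^+ j * (tree_poly N V N)`_1 : R).
    by apply: cvgB => //; apply: cvgM => //; exact: cvg_cst.
  have d0 : 0 < (tree_poly N V N)`_j.+1 - B ^+ j * (tree_poly N V N)`_1.
    by rewrite T1 mulr1 subr_gt0.
  by apply: filterS (cvgr_gt _ h _ d0) => t; rewrite subr_gt0.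
near=> t.
have t1 : 1 < t by near: t; exact: nbhs_pinfty_gt.
have tx : V^-1 / x0 < t by near: t; exact/nbhs_pinfty_gt/num_real.
have [S0 PS Sup] := spec t t1 tx.
have Slow : B < supp_max (nu t) / t.
  apply: (supp_max_power_gt mu_nonneg L1 muL mean t1 (nu_power t t1) (ltW B0) jN S0 PS).
  by near: t.
have Ue : V * expR (1 + c / t) < expR 1 * V + e.
  by near: t; apply: (cvgr_lt _ upper); rewrite ltrDl.
have Be : expR 1 * V - e <= B by rewrite le_max lexx.
by rewrite ltr_distlC; apply/andP; split; lra.
Unshelve. all: by end_near. Qed.
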